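(* Let $F_k$ be the free group of rank $k$ and let $H\le F_k$ be a finitely generated subgroup of rank at least $k-1$. Then $H$ is a free factor of $F_k$ if and only if $H$ is measure preserving. In particular, for every $w\in F_2$, $w$ is primitive in $F_2$ if and only if $w$ is measure preserving.
   Context: A subgroup $H\le F_k$ is a free factor of $F_k$ if there is $H'\le F_k$ with $H*H'=F_k$. An element of a free group is primitive if it belongs to some basis of it. For a finite group $G$, let $\alpha_G$ be a homomorphism chosen uniformly at random from the finite set $\mathrm{Hom}(F_k,G)$ (which has $|G|^k$ elements). A finitely generated subgroup $H\le F_k$ is measure preserving if for every finite group $G$ the restriction $\alpha_G|_H$ is uniformly distributed in $\mathrm{Hom}(H,G)$. A word $w\in F_k$ is measure preserving if for every finite group $G$ the element $\alpha_G(w)$ is uniformly distributed in $G$. *)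

(* Defs.v *)
(* Mathematical Components, with the sets, cardinality and classical logic of
   MathComp-Analysis. *)
From HB Require Import structures.
From mathcomp Require Import all_boot all_fingroup.
From mathcomp Require Import boolp classical_sets cardinality.

Set Implicit Arguments.
Unset Strict Implicit.
Unset Printing Implicit Defensive.

Local Open Scope group_scope.

(* A subgroup of a possibly infinite group G is a predicate H : groupClosed G.
   The predicate is boolean, which is no restriction in the presence of
   boolp. [subgroup H] is H seen as a group in its own right. *)
Definition subgroup (G : groupType) (H : groupClosed G) : Type :=
  {x : G | x \in H}.

Section SubgroupIsGroup.
Variables (G : groupType) (H : groupClosed G).

Let P : pred G := fun x => x \in H.

HB.instance Definition _ := [isSub of subgroup H for @sval G P].
HB.instance Definition _ := [Choice of subgroup H by <:].

Let P_group_closed : group_closed P.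
Proof. by split; [exact: gpred1 | move=> x y Hx Hy; exact: gpredF]. Qed.

HB.instance Definition _ :=
  SubChoice_isSubGroup.Build G P (subgroup H) P_group_closed.

End SubgroupIsGroup.

Definition incl (G : groupType) (H : groupClosed G) (h : subgroup H) : G :=
  sval h.

Lemma incl_is_multiplicative (G : groupType) (H : groupClosed G) :
  {morph @incl G H : x y / x * y}.
Proof. by move=> x y; apply: (valM x y). Qed.

HB.instance Definition _ (G : groupType) (H : groupClosed G) :=
  isMultiplicative.Build (subgroup H) G (@incl G H)
    (@incl_is_multiplicative G H).

(* A generates G: no proper subgroup of G contains A. *)
Definition generates (G : groupType) (A : set G) : Prop :=
  forall S : groupClosed G,
    (forall x, A x -> x \in S) -> forall x : G, x \in S.

Definition finitely_generated (G : groupType) : Prop :=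
  exists A : set G, finite_set A /\ generates A.

(* B is a basis of G, i.e. G is free on B: every map from B to a group K
   extends uniquely to a homomorphism from G to K. Only the values of f on B
   matter. *)
Definition basis (G : groupType) (B : set G) : Prop :=
  forall (K : groupType) (f : G -> K),
    exists2 g : {multiplicative G -> K}, (forall x, B x -> g x = f x) &
      forall g' : {multiplicative G -> K},
        (forall x, B x -> g' x = f x) -> g' =1 g.

Definition has_rank (G : groupType) (r : nat) : Prop :=
  exists B : set G, basis B /\ (B #= `I_r)%card.

Definition primitive (G : groupType) (w : G) : Prop :=
  exists B : set G, basis B /\ B w.

(* G is the (internal) free product H * H': together with the two inclusions,
   it is the coproduct of H and H' in the category of groups. *)
Definition is_free_product (G : groupType) (H H' : groupClosed G) : Prop :=
  forall (K : groupType) (f : {multiplicative subgroup H -> K})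
    (f' : {multiplicative subgroup H' -> K}),
    exists2 g : {multiplicative G -> K},
      (forall h, g (incl h) = f h) /\ (forall h, g (incl h) = f' h) &
      forall g' : {multiplicative G -> K},
        (forall h, g' (incl h) = f h) /\ (forall h, g' (incl h) = f' h) ->
        g' =1 g.

Definition free_factor (G : groupType) (H : groupClosed G) : Prop :=
  exists H' : groupClosed G, is_free_product H H'.

(* The free group of rank k, as the set of reduced words in the letters
   (i, false), the i-th generator, and (i, true), its inverse. *)
Section FreeGroup.
Variable k : nat.

Local Notation letter := ('I_k * bool)%type.

Definition linv (a : letter) : letter := (a.1, ~~ a.2).

Fixpoint reduced (s : seq letter) : bool :=
  if s is a :: s' then
    (if s' is b :: _ then b != linv a else true) && reduced s'
  else true.

Definition free_group : Type := {s : seq letter | reduced s}.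
HB.instance Definition _ := [isSub of free_group for @sval _ reduced].
HB.instance Definition _ := [Choice of free_group by <:].

Definition push (a : letter) (s : seq letter) : seq letter :=
  if s is b :: s' then if b == linv a then s' else a :: s else [:: a].

Lemma linvK : involutive linv.
Proof. by case=> i b; rewrite /linv /= negbK. Qed.

Lemma push_reduced a s : reduced s -> reduced (push a s).
Proof.
case: s => [|b s] //= /andP[Hb Hs].
by case: eqVneq => [_|Hn] //=; rewrite Hn Hb Hs.
Qed.

Lemma foldr_push_reduced s t : reduced t -> reduced (foldr push t s).
Proof. by move=> Ht; elim: s => //= a s; apply: push_reduced. Qed.

Lemma push_linv a s : reduced s -> push (linv a) (push a s) = s.
Proof.
case: s => [|b s] /=; first by rewrite linvK eqxx.
move=> /andP[Hb Hs]; case: eqVneq => [Eb|Hn] /=; last by rewrite linvK eqxx.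
case: s Hb Hs => [|c s] /=; first by rewrite Eb.
by rewrite Eb; case: eqVneq.
Qed.

Lemma foldr_push_id s : reduced s -> foldr push [::] s = s.
Proof.
elim: s => //= a s IH /andP[Ha Hs]; rewrite (IH Hs).
by case: s Ha {IH Hs} => //= b s /negPf->.
Qed.

Lemma foldr_push_push a s t : reduced s -> reduced t ->
  foldr push t (push a s) = push a (foldr push t s).
Proof.
case: s => [|b s] //= /andP[_ Hs] Ht; case: eqVneq => [->|] //=.
by rewrite -{1}(linvK a) push_linv // foldr_push_reduced.
Qed.

Lemma foldr_pushA s t u : reduced s -> reduced t -> reduced u ->
  foldr push u (foldr push t s) = foldr push (foldr push u t) s.
Proof.
elim: s => //= a s IH /andP[_ Hs] Ht Hu.
by rewrite foldr_push_push ?foldr_push_reduced // IH.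
Qed.

Lemma reduced_rcons s a :
  reduced (rcons s a) = (if s is b :: s' then last b s' != linv a else true)
                        && reduced s.
Proof.
elim: s => //= b [|c s] IH /=.
  by rewrite !andbT [in LHS]eq_sym (can2_eq linvK linvK).
by rewrite /= in IH; rewrite IH; case: (c != _) => //=; rewrite ?andbF.
Qed.

Definition winv (s : seq letter) : seq letter := rev (map linv s).

Lemma winv_reduced s : reduced s -> reduced (winv s).
Proof.
rewrite /winv; elim: s => //= a s IH /andP[Ha /IH Hs].
rewrite rev_cons reduced_rcons Hs andbT.
case: s Ha {IH Hs} => //= b s Hb; rewrite rev_cons.
have L c r (x : letter) : (if rcons r x is d :: q then last d q != c else true) =
  (x != c) by case: r => //= d q; rewrite last_rcons.
by rewrite L linvK (can2_eq linvK linvK).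
Qed.

Lemma winvl s t : reduced t -> foldr push (foldr push t s) (winv s) = t.
Proof.
rewrite /winv; elim: s t => //= a s IH t Ht.
rewrite rev_cons foldr_rcons push_linv ?foldr_push_reduced //.
exact: IH.
Qed.

Lemma winvK : involutive winv.
Proof.
by move=> s; rewrite /winv map_rev revK (mapK linvK).
Qed.

Definition fg_one : free_group := exist _ [::] isT.
Definition fg_inv (u : free_group) : free_group :=
  exist _ (winv (sval u)) (winv_reduced (svalP u)).
Definition fg_mul (u v : free_group) : free_group :=
  exist _ (foldr push (sval v) (sval u))
    (foldr_push_reduced (sval u) (svalP v)).

Lemma fg_mulA : associative fg_mul.
Proof.
move=> u v w; apply/val_inj; symmetry.
exact: foldr_pushA (svalP u) (svalP v) (svalP w).
Qed.
Lemma fg_mul1 : left_id fg_one fg_mul.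
Proof. by move=> u; apply/val_inj. Qed.
Lemma fg_mulr1 : right_id fg_one fg_mul.
Proof. by move=> u; apply/val_inj; exact: foldr_push_id (svalP u). Qed.
Lemma fg_mulV : left_inverse fg_one fg_inv fg_mul.
Proof.
move=> u; apply/val_inj => /=.
by rewrite -[X in foldr _ X _](foldr_push_id (svalP u)) winvl.
Qed.
Lemma fg_mulrV : right_inverse fg_one fg_inv fg_mul.
Proof.
move=> u; rewrite -[u in fg_mul u _](_ : fg_inv (fg_inv u) = u) ?fg_mulV //.
by apply/val_inj; rewrite /= winvK.
Qed.

HB.instance Definition _ :=
  isGroup.Build free_group fg_mulA fg_mul1 fg_mulr1 fg_mulV fg_mulrV.

Definition gen (i : 'I_k) : free_group := exist _ [:: (i, false)] isT.

(* The homomorphism from the free group to K with gen i |-> f i. *)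
Section FreeHom.
Variables (K : groupType) (f : 'I_k -> K).

Definition eval_letter (a : letter) : K :=
  if a.2 then (f a.1)^-1 else f a.1.

Definition free_hom (w : free_group) : K :=
  \prod_(a <- sval w) eval_letter a.

Lemma free_hom_is_multiplicative : {morph free_hom : u v / u * v}.
Proof.
have Hp a s : \prod_(b <- push a s) eval_letter b =
    eval_letter a * \prod_(b <- s) eval_letter b.
  case: s => [|b s] /=; first by rewrite big_seq1 big_nil mulg1.
  case: eqVneq => [->|_]; rewrite !big_cons // mulgA.
  by case: a => i []; rewrite /eval_letter /= ?mulgV ?mulVg mul1g.
move=> u v; rewrite /free_hom /=.
elim: (sval u) => [|a s IH] /=; first by rewrite big_nil mul1g.
by rewrite Hp IH big_cons mulgA.
Qed.

HB.instance Definition _ :=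
  isMultiplicative.Build free_group K free_hom free_hom_is_multiplicative.

Lemma free_hom_gen i : free_hom (gen i) = f i.
Proof. by rewrite /free_hom /= big_seq1. Qed.

End FreeHom.
End FreeGroup.

(* Evaluation at the generators is a bijection from Hom(F_k, K) to the set of
   maps 'I_k -> K: existence is free_hom_gen, uniqueness is free_homE. *)
Lemma free_homE k (K : groupType) (g : {multiplicative free_group k -> K}) :
  g =1 free_hom (fun i => g (gen i)).
Proof.
have g1 : g 1 = 1 by apply: (mulgI (g 1)); rewrite -gmulfM !mulg1.
have gV x : g x^-1 = (g x)^-1.
  by apply: (mulgI (g x)); rewrite -gmulfM !mulgV g1.
move=> [s Hs]; rewrite /free_hom /=; elim: s Hs => [|a s IH] Hs.
  by rewrite big_nil -g1; congr (g _); apply/val_inj.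
have Hs' : reduced s by case/andP: Hs.
have -> : exist _ (a :: s) Hs = (if a.2 then (gen a.1)^-1 else gen a.1) *
     (exist _ s Hs' : free_group k).
  have E : a :: s = push a s.
    by case: s Hs {IH Hs'} => //= b s /andP[/negPf->].
  by apply/val_inj; rewrite /= [LHS]E; case: a {Hs E} => i [].
rewrite gmulfM IH big_cons; congr (_ * _).
by case: a {Hs} => i []; rewrite /eval_letter //= gV.
Qed.

Lemma gen_inj k : injective (@gen k).
Proof. by move=> i j [->]. Qed.

Lemma free_group_rank k : has_rank (free_group k) k.
Proof.
exists (range (@gen k)); split.
  move=> K f; exists (free_hom (fun i => f (gen i))).
    by move=> _ [i _ <-]; apply: free_hom_gen.
  move=> g Hg w; rewrite free_homE; apply: eq_bigr => a _.
  by rewrite /eval_letter Hg //; exists a.1.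
rewrite card_eq_sym; apply: card_eq_trans card_II _.
by rewrite card_eq_sym; apply: inj_card_eq => x y _ _; apply: gen_inj.
Qed.

(* The random variable X on the probability space Omega, with its uniform
   probability, is uniformly distributed on the set A. *)
Definition uniformly_distributed (Omega : finType) (T : Type)
    (X : Omega -> T) (A : set T) : Prop :=
  (forall o, A (X o)) /\
  forall a b, A a -> A b ->
    #|[pred o | `[< X o = a >]]| = #|[pred o | `[< X o = b >]]|.

(* Hom(H, K) as a set of functions. *)
Definition Hom (H K : groupType) : set (H -> K) :=
  fun phi => {morph phi : x y / x * y}.

(* A uniformly random homomorphism from F_k to the finite group gT is
   [free_hom f] for a uniformly random f : {ffun 'I_k -> gT}, see free_homE. *)
Definition measure_preserving k (H : groupClosed (free_group k)) : Prop :=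
  forall gT : finGroupType,
    uniformly_distributed
      (fun (f : {ffun 'I_k -> gT}) (h : subgroup H) => free_hom f (incl h))
      (@Hom (subgroup H) gT).

Definition measure_preserving_word k (w : free_group k) : Prop :=
  forall gT : finGroupType,
    uniformly_distributed (fun f : {ffun 'I_k -> gT} => free_hom f w) setT.

(* Main.v *)
(* Let b be a basis of H, r its size, and let Gamma be a finite connected
   subgraph of the Schreier graph of H in F_k whose loops at the base vertex
   read exactly H. For a random action of F_k on n points, the expected number
   of common fixed points of H is n^(1-r) if H is measure preserving; it is also
   the sum, over the quotients of Gamma that are again graphs with deterministic
   edges, of the expected number of injective lifts of the quotient, which is
   n^chi (1 + c/n + ...) where chi is the Euler characteristic of the quotient
   and c is an explicit difference of binomial coefficients. Comparing the two
   leading coefficients, every proper quotient has chi <= -r, and the number of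
   those with chi = -r is the Euler characteristic of the graph whose vertices
   are the pairs of distinct vertices of Gamma.

   Each pair generates a quotient with chi = -r, whose group is the free product
   of H and a cyclic group <u>; as <H, u> = <H, u'> forces u' to be in H u H or
   in H u^-1 H, two pairs generating the same quotient lie in the same component
   of the graph of pairs. Since a graph has at least as many components as its
   Euler characteristic, every quotient with chi = -r is generated by a pair. If
   r = k - 1 and Gamma has several vertices, then its quotient with one vertex
   is of this kind, so F_k = <H, u> and a basis of H extends to one of F_k. *)

From HB Require Import structures.
Require Import Defs.
From mathcomp Require Import all_boot all_fingroup.
From mathcomp Require Import order ssralg ssrnum ssrint poly zify.
From mathcomp Require Import boolp classical_sets cardinality.

Set Implicit Arguments.
Unset Strict Implicit.
Unset Printing Implicit Defensive.

Local Open Scope group_scope.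

(** * Subgroups, homomorphisms and bases *)

Lemma groupClosed_of (G : groupType) (P : G -> Prop) :
  P 1 -> (forall x y, P x -> P y -> P (x * y)) -> (forall x, P x -> P x^-1) ->
  exists S : groupClosed G, forall x, (x \in S) = `[< P x >].
Proof.
move=> P1 PM PV; pose S : pred G := fun x => `[< P x >].
have S1 : umagma_closed S.
  by split; [exact/asboolP | move=> x y /asboolP Px /asboolP Py; exact/asboolP/PM].
have SV : invg_closed S by move=> x /asboolP Px; exact/asboolP/PV.
pose c1 := isMulClosed.Build G S S1.2.
pose c2 := isMul1Closed.Build G S S1.1.
pose c3 := isInvClosed.Build G S SV.
pose S' : groupClosed G := HB.pack S c1 c2 c3.
by exists S'.
Qed.

Lemma mult_of (G K : groupType) (f : G -> K) :
  {morph f : x y / x * y} -> exists g : {multiplicative G -> K}, g =1 f.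
Proof.
move=> fM; pose g : {multiplicative G -> K} :=
  HB.pack f (isMultiplicative.Build G K f fM).
by exists g.
Qed.

Section Morph.
Variables (G K : groupType) (f : G -> K).
Hypothesis fM : {morph f : x y / x * y}.

Lemma morph_one : f 1 = 1.
Proof. by apply: (mulgI (f 1)); rewrite -fM !mulg1. Qed.

Lemma morph_inv x : f x^-1 = (f x)^-1.
Proof. by apply: (mulgI (f x)); rewrite -fM !mulgV morph_one. Qed.

End Morph.

Section Basis.
Variables (G : groupType) (B : set G).

Lemma generates_ind (P : G -> Prop) : generates B ->
  P 1 -> (forall x y, P x -> P y -> P (x * y)) -> (forall x, P x -> P x^-1) ->
  (forall x, B x -> P x) -> forall x, P x.
Proof.
move=> gB P1 PM PV PB x; have [S SP] := groupClosed_of P1 PM PV.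
have : x \in S by apply: gB => y /PB Py; rewrite SP; apply/asboolP.
by rewrite SP => /asboolP.
Qed.

Lemma generates_eq (K : groupType) (f g : G -> K) :
  {morph f : x y / x * y} -> {morph g : x y / x * y} ->
  generates B -> (forall x, B x -> f x = g x) -> f =1 g.
Proof.
move=> fM gM gB fg; apply: (generates_ind gB) => //.
- by rewrite !morph_one.
- by move=> x y fx fy; rewrite fM gM fx fy.
- by move=> x fx; rewrite !morph_inv // fx.
Qed.

(** If [S] contains [B], freeness gives a homomorphism from [G] to [S] that is the identity on [B];
    followed by the inclusion it is the identity of [G] by uniqueness. *)
Lemma basis_generates : basis B -> generates B.
Proof.
move=> bB S BS.
pose f x : subgroup S := if boolP (x \in S) is AltTrue h then exist _ x h else 1.
have [g gB _] := bB _ f.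
have [h hB hU] := bB _ (fun x => x).
have gM : {morph (fun x => incl (g x)) : x y / x * y}.
  by move=> x y; rewrite gmulfM; apply: (valM (g x) (g y)).
have [g1 g1E] := mult_of gM.
have [g2 g2E] := @mult_of G G id (fun x y => erefl).
have E1 : g1 =1 h.
  apply: hU => x Bx; rewrite g1E gB // /f.
  by case: {-}_ / boolP => [//|]; rewrite BS.
have E2 : g2 =1 h by apply: hU => x Bx; rewrite g2E.
by move=> x; rewrite -[x]g2E E2 -E1 g1E; apply: valP.
Qed.

Lemma basisP : basis B <-> generates B /\
  forall (K : groupType) (f : G -> K), exists2 g : G -> K,
    {morph g : x y / x * y} & forall x, B x -> g x = f x.
Proof.
split=> [bB|[gB eB] K f].
  split; first exact: basis_generates.
  by move=> K f; have [g gf _] := bB K f; exists g => //; exact: gmulfM.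
have [g0 gM gf] := eB K f; have [g gE] := mult_of gM.
exists g => [x Bx|g' g'f]; first by rewrite gE gf.
apply: generates_eq gB _; [exact: gmulfM|exact: gmulfM|].
by move=> x Bx; rewrite gE gf // g'f.
Qed.
End Basis.

(** * Words and labelled graphs *)

Notation letter k := ('I_k * bool)%type.

Section Letters.
Variable k : nat.

Definition elt (a : letter k) : free_group k := eval_letter (@gen k) a.

Lemma elt_mul a (x : free_group k) : sval (elt a * x) = push a (sval x).
Proof. by case: a => i []. Qed.

Lemma elt_inv a : elt (linv a) = (elt a)^-1.
Proof. by case: a => i []; rewrite /elt /eval_letter //= invgK. Qed.

Lemma prod_elt (x : free_group k) : \prod_(a <- sval x) elt a = x.
Proof.
have [g gE] := @mult_of _ (free_group k) id (fun x y => erefl).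
rewrite -[RHS]gE free_homE; apply: eq_bigr => a _.
by rewrite /elt /eval_letter gE.
Qed.

Lemma free_hom_elt (K : groupType) (f : 'I_k -> K) a :
  free_hom f (elt a) = eval_letter f a.
Proof.
case: a => i b; rewrite /elt /eval_letter; case: b => /=; rewrite ?free_hom_gen //.
by rewrite morph_inv ?free_hom_gen //; exact: gmulfM.
Qed.

Lemma free_group_ind (P : free_group k -> Prop) :
  P 1 -> (forall a x, P x -> P (elt a * x)) -> forall x, P x.
Proof.
move=> P1 PM x; rewrite -(prod_elt x); elim: (sval x) => [|a s IH].
  by rewrite big_nil.
by rewrite big_cons; exact: PM.
Qed.

Lemma gen_generates : generates (range (@gen k)).
Proof.
move=> S gS; apply: free_group_ind => [|[i b] x xS]; first exact: gpred1.
by apply: gpredM => //; case: b; rewrite /elt /eval_letter /= ?gpredV; apply: gS; exists i.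
Qed.

End Letters.

(* A step function satisfying step_inv is a graph whose edges are labelled by
   the generators, with at most one edge of each label entering or leaving each
   vertex. *)
Section Run.
Variables (k : nat) (T : Type) (step : letter k -> T -> option T).

Fixpoint run (v : T) (s : seq (letter k)) : option T :=
  if s is a :: s' then obind (run^~ s') (step a v) else Some v.

Definition reads (v : T) (x : free_group k) (w : T) : Prop :=
  run v (sval x) = Some w.

Lemma run_cat v s t : run v (s ++ t) = obind (run^~ t) (run v s).
Proof. by elim: s v => //= a s IH v; case: (step a v). Qed.

Lemma run_rcons v s a : run v (rcons s a) = obind (step a) (run v s).
Proof.
rewrite -cats1 run_cat; case: (run v s) => //= w.
by case: (step a w).
Qed.

Definition step_inv := forall a v w, step a v = Some w -> step (linv a) w = Some v.

Hypothesis stepV : step_inv.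

Lemma reads_elt a v w : step a v = Some w -> reads v (elt a) w.
Proof.
rewrite /reads; have -> : sval (elt a) = [:: a] by case: a => i [].
by move=> /= ->.
Qed.

(** By [stepV], cancelling a letter against its inverse removes a step back and forth along one
    edge. *)
Lemma run_push a s v w : run v (a :: s) = Some w -> run v (push a s) = Some w.
Proof.
case: s => [|b s] //; rewrite /push; case: eqVneq => [->|_] //=.
by case E: (step a v) => [z|] //=; rewrite (stepV E).
Qed.

Lemma reads_step a v w x z : step a v = Some w -> reads w x z -> reads v (elt a * x) z.
Proof. by move=> E R; rewrite /reads elt_mul; apply: run_push; rewrite /= E. Qed.

Lemma reads_prod s v w : run v s = Some w -> reads v (\prod_(a <- s) elt a) w.
Proof.
elim: s v => [|a s IH] v /=; first by rewrite big_nil => -[->].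
rewrite big_cons; case E: (step a v) => [z|] //= /IH; exact: reads_step.
Qed.

Lemma readsM v w z x y : reads v x w -> reads w y z -> reads v (x * y) z.
Proof.
move=> vx wy; rewrite -(prod_elt x) -(prod_elt y) -big_cat.
by apply: reads_prod; rewrite run_cat vx.
Qed.

Lemma readsV v w x : reads v x w -> reads w x^-1 v.
Proof.
have invp : x^-1 = \prod_(a <- winv (sval x)) elt a.
  by rewrite -[LHS]prod_elt.
rewrite invp /reads => H; apply: reads_prod; rewrite /winv.
elim: (sval x) v H => [|a s IH] v /=; first by case=> ->.
case E: (step a v) => [z|] //= /IH; rewrite rev_cons run_rcons => ->.
exact: stepV.
Qed.

Lemma reads_fun v w w' x : reads v x w -> reads v x w' -> w = w'.
Proof. by rewrite /reads => -> []. Qed.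

Lemma reads_ind (P : T -> free_group k -> T -> Prop) :
  (forall v, P v 1 v) ->
  (forall a v w x z, step a v = Some w -> P w x z -> P v (elt a * x) z) ->
  forall v x w, reads v x w -> P v x w.
Proof.
move=> P1 PM v x w; rewrite /reads -{2}(prod_elt x).
elim: (sval x) v => [|a s IH] v /=; first by rewrite big_nil => -[->].
rewrite big_cons; case E: (step a v) => [z|] //= /IH; exact: PM.
Qed.

End Run.

(** * Partial permutations and their extensions *)

Section PartialPerm.
Variables (k : nat) (V T : finType) (step : letter k -> V -> option V).
Hypothesis stepV : step_inv step.

Lemma reads_perm (f : 'I_k -> {perm T}) (phi : V -> T) :
  (forall j v w, step (j, false) v = Some w -> f j (phi v) = phi w) ->
  forall v x w, reads step v x w -> free_hom f x (phi v) = phi w.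
Proof.
move=> H; apply: reads_ind => [v|a v w x z E IH].
  by rewrite morph_one ?perm1 //; exact: gmulfM.
rewrite gmulfM permM -IH /= free_hom_elt; congr (_ _).
case: a E => j [] E; rewrite /eval_letter /=; last exact: H.
have /H <- := stepV E; exact: permK.
Qed.

End PartialPerm.

Section PermExtension.
Variable T : finType.

Lemma perm_extension (D : {set T}) (g : T -> T) : {in D &, injective g} ->
  exists s : {perm T}, {in D, s =1 g}.
Proof.
have [n] := ubnP #|D|; elim: n => // n IH in D *; rewrite ltnS => Dn gI.
have [->|[x xD]] := set_0Vmem D; first by exists 1%g => x; rewrite inE.
have sD y : y \in D :\ x -> y \in D by case/setD1P.
have [||s sg] := IH (D :\ x).
- by move: Dn; rewrite (cardsD1 x) xD.
- by move=> y z /sD yD /sD zD; exact: gI.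
(* The transposition corrects the value at [x] and fixes the images of the other points of [D]. *)
exists (s * tperm (s x) (g x)) => y yD; rewrite permM.
have [->|nyx] := eqVneq y x; first by rewrite tpermL.
have yDx : y \in D :\ x by rewrite !inE nyx.
have sxy : s x != s y by rewrite (inj_eq (@perm_inj _ s)) eq_sym.
have gxy : g x != s y by rewrite sg //; apply: contra nyx => /eqP /gI ->.
by rewrite tpermD // sg.
Qed.

(** The extensions are the products of one of them, [s0], with the permutations supported off
    [D]. *)
Lemma card_perm_extension (D : {set T}) (g : T -> T) : {in D &, injective g} ->
  #|[set s : {perm T} | [forall x in D, s x == g x]]| = (#|T| - #|D|)`!.
Proof.
move=> /perm_extension [s0 s0g].
have -> : [set s : {perm T} | [forall x in D, s x == g x]] =
    (fun s => s * s0) @: [set s : {perm T} | perm_on (~: D) s].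
  apply/setP => s; rewrite !inE; apply/'forall_implyP/imsetP.
    move=> H; exists (s * s0^-1); rewrite ?mulgKV // inE.
    apply/fintype.subsetP => x; rewrite !inE; apply: contraNN => xD.
    by rewrite permM (eqP (H x xD)) -s0g // permK.
  move=> [t]; rewrite inE => tD -> x xD; rewrite permM (out_perm tD) ?inE ?xD //.
  by rewrite s0g.
rewrite card_imset; last exact: mulIg.
by rewrite cardsE card_perm cardsCs finset.setCK.
Qed.
End PermExtension.

(** * Finite pieces of Schreier graphs *)

Section Schreier.
Variables (k : nat) (H : groupClosed (free_group k)).
Local Notation G := (free_group k).

(** A canonical element of the coset H x: [choose] depends only on the predicate, so equal cosets
    get equal representatives. *)
Definition coset_rep (x : G) : G := choose (fun y => y * x^-1 \in H) x.

Lemma coset_rep_in x : coset_rep x * x^-1 \in H.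
Proof. by apply: (@chooseP _ (fun y => y * x^-1 \in H) x); rewrite mulgV gpred1. Qed.

Lemma coset_rep_eq x y : (coset_rep x == coset_rep y) = (x * y^-1 \in H).
Proof.
have aux u v : u * v^-1 \in H -> coset_rep u = coset_rep v.
  move=> uv; rewrite /coset_rep.
  have E : (fun z => z * u^-1 \in H) =1 (fun z => z * v^-1 \in H).
    by move=> z; rewrite -(gpredMr _ uv) mulgA mulgKV.
  by rewrite (eq_choose E); apply: choose_id => //; rewrite mulgV gpred1.
apply/eqP/idP => [E|/aux //].
have := coset_rep_in x; rewrite E -gpredV invgM invgK => hx.
by have := gpredM _ _ hx (coset_rep_in y); rewrite mulgA mulgKV.
Qed.

Variable L : seq G.

Let word (s : seq (letter k)) : G := \prod_(a <- s) elt a.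

(** Cosets of all prefixes of the words in [L], so that these words can be read from the base vertex
    inside a finite piece of the Schreier graph. *)
Let verts : seq G :=
  coset_rep 1 :: [seq coset_rep (word (take i (sval x))) | x <- L, i <- iota 0 (size (sval x)).+1].

Let V : finType := seq_sub verts.

(** [insub] drops the edges that leave the finite piece. *)
Let step (a : letter k) (v : V) : option V := insub (coset_rep (val v * elt a)).

Let v0 : V := SeqSub (mem_head _ _).

Let coset_rep_vert (v : V) : coset_rep (val v) = val v.
Proof.
have : val v \in verts := valP v.
have aux x : coset_rep (coset_rep x) = coset_rep x.
  by apply/eqP; rewrite coset_rep_eq coset_rep_in.
by rewrite inE => /orP[/eqP-> //|/allpairsPdep[x [i [_ _ ->]]]].
Qed.

Let stepP a v w : reflect (step a v = Some w) (coset_rep (val v * elt a) == val w).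
Proof.
rewrite /step; apply: (iffP eqP) => [E|].
  by rewrite E valK.
by case: insubP => // u _ <- [->].
Qed.

Let step_vert a v w : (step a v == Some w) = (val v * elt a * (val w)^-1 \in H).
Proof. by rewrite -coset_rep_eq coset_rep_vert; apply/eqP/idP => /stepP. Qed.

Lemma schreier_graph : exists (W : finType) (st : letter k -> W -> option W) (w0 : W),
  [/\ step_inv st,
      forall x v, reads st w0 x v -> (x \in H) = (v == w0),
      forall x, x \in L -> exists v, reads st w0 x v &
      forall v, exists x, reads st w0 x v].
Proof.
have stV : step_inv step.
  move=> a v w /eqP; rewrite step_vert => E; apply/eqP.
  by rewrite step_vert elt_inv -gpredV !invgM !invgK mulgA.
(* Reading [s] from [v] to [w] gives the equality of cosets H v s = H w. *)
have stE s v w : run step v s = Some w -> val v * word s * (val w)^-1 \in H.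
  rewrite /word; elim: s v => [|a s IH] v /=.
    by case=> ->; rewrite big_nil mulg1 mulgV gpred1.
  case E: (step a v) => [z|] //= /IH zw; move/eqP: E; rewrite step_vert => vz.
  by have := gpredM _ _ vz zw; rewrite !mulgA mulgKV big_cons mulgA.
have pre x i : x \in L -> (i <= size (sval x))%N -> exists2 v : V,
    run step v0 (take i (sval x)) = Some v & val v = coset_rep (word (take i (sval x))).
  move=> xL; elim: i => [|i IH] ix.
    by exists v0; rewrite ?take0 // /word big_nil.
  have [v vr vE] := IH (ltnW ix).
  have zV : coset_rep (word (take i.+1 (sval x))) \in verts.
    by rewrite inE; apply/orP; right; apply/allpairsPdep; exists x, i.+1; rewrite mem_iota.
  exists (SeqSub zV) => //.
  have [a0 _] : exists a0 : letter k, True by case: (sval x) ix => // a0; exists a0.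
  rewrite [X in run _ _ X](take_nth a0) // run_rcons vr /=; apply/stepP => /=.
  rewrite (take_nth a0) // /word -cats1 big_cat big_seq1 /=.
  by rewrite coset_rep_eq invgM mulgA mulgK vE coset_rep_in.
exists V, step, v0; split=> //.
- move=> x v /stE; rewrite /word prod_elt => xv.
  have h0 : coset_rep 1 \in H by have := coset_rep_in 1; rewrite invg1 mulg1.
  rewrite -val_eqE /= -(coset_rep_vert v) coset_rep_eq invg1 mulg1.
  by rewrite -(gpredMl _ h0) -(gpredMl (val v) xv) mulgKV.
- move=> x xL; have [|v vr _] := pre x (size (sval x)) xL; first by [].
  by exists v; rewrite /reads -vr take_size.
- move=> v; have := valP v; rewrite inE => /orP[/eqP E|/allpairsPdep[x [i [xL iL E]]]].
    by exists 1; rewrite /reads /=; congr Some; apply/val_inj.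
  have [|w wr wE] := pre x i xL; first by rewrite -ltnS; rewrite mem_iota in iL.
  exists (word (take i (sval x))).
  have -> : v = w by apply/val_inj; rewrite wE -E.
  exact: (reads_prod stV wr).
Qed.
End Schreier.

Section Residual.
Variable k : nat.

(* The partial permutations of the Schreier graph extend to permutations. *)
Lemma free_group_residually_finite (x : free_group k) : x <> 1 ->
  exists (gT : finGroupType) (f : 'I_k -> gT), free_hom f x <> 1.
Proof.
move=> x1.
(* For the trivial subgroup the cosets are single elements, so [x] leads from [v0] to a different
   vertex. *)
have [|y z|y|H HE] := @groupClosed_of (free_group k) (fun y => y = 1).
- by [].
- by move=> -> ->; rewrite mulg1.
- by move=> ->; rewrite invg1.
have [V [step [v0 [stV stH stL _]]]] := schreier_graph H [:: x].
have [|v xv] := stL x; first by rewrite inE.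
pose g j (u : V) := if step (j, false) u is Some w then w else u.
have [f fE] : exists f : 'I_k -> {perm V},
    forall j u w, step (j, false) u = Some w -> f j u = w.
  suff /choice[f fE] : forall j, exists s : {perm V},
      forall u w, step (j, false) u = Some w -> s u = w.
    by exists f => j; exact: fE.
  move=> j; have [|s sE] := @perm_extension V [set u | step (j, false) u] (g j).
    move=> u w; rewrite !inE /g.
    case Eu: (step _ u) => [u'|] //; case Ew: (step _ w) => [w'|] // _ _ E; subst w'.
    by have := stV _ _ _ Eu; rewrite (stV _ _ _ Ew) => -[].
  by exists s => u w E; rewrite sE ?inE /g E.
exists {perm V}, f => fx.
have := @reads_perm _ _ _ _ stV f id fE _ _ _ xv; rewrite fx perm1 /= => /esym /eqP.
by rewrite -(stH _ _ xv) HE => /asboolP.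
Qed.

End Residual.

(** * Counting homomorphisms fixing a point *)

Lemma has_rank_range (G : groupType) r : has_rank G r ->
  exists2 b : 'I_r -> G, injective b & basis (range b).
Proof.
move=> [B [bB BI]].
have : ([set: 'I_r] #= B)%card.
  by rewrite card_eq_sym; apply: card_eq_trans BI card_II.
move=> /card_bijP[f [g fK gK]].
pose inT (i : 'I_r) : [set: 'I_r]%classic := SigSub (mem_set (I : [set: 'I_r]%classic i)).
exists (fun i => val (f (inT i))).
  by move=> i j /val_inj /(can_inj fK) /(congr1 val).
suff -> : range (fun i => val (f (inT i))) = B by [].
apply/seteqP; split=> [_ [i _ <-]|x Bx]; first exact: set_valP.
exists (val (g (SigSub (mem_set Bx)))) => //.
have -> : inT (val (g (SigSub (mem_set Bx)))) = g (SigSub (mem_set Bx)) by exact: val_inj.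
by rewrite gK.
Qed.

Lemma card_pred_le (T U : finType) (A : {set T}) (B : {set U}) (h : T -> U) :
  {in A &, injective h} -> (forall x, x \in A -> h x \in B) -> #|A| <= #|B|.
Proof.
move=> hI hB; rewrite -(card_in_imset hI); apply: subset_leq_card.
by apply/fintype.subsetP => _ /imsetP[x xA ->]; exact: hB.
Qed.

Section Code.
Variables (k r : nat) (H : groupClosed (free_group k)).
Variable b : 'I_r -> subgroup H.
Hypothesis b_inj : injective b.
Hypothesis b_basis : basis (range b).

Lemma basis_ext (K : groupType) (f : 'I_r -> K) :
  exists2 g : subgroup H -> K, {morph g : x y / x * y} & forall i, g (b i) = f i.
Proof.
have [_ eB] := (basisP _).1 b_basis.
pose f' h := if [pick i | b i == h] is Some i then f i else 1.
have [g gM gf] := eB K f'; exists g => // i; rewrite gf; last by exists i.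
by rewrite /f'; case: pickP => [j /eqP/b_inj -> //|/(_ i)]; rewrite eqxx.
Qed.

Lemma basis_eq (K : groupType) (f g : subgroup H -> K) :
  {morph f : x y / x * y} -> {morph g : x y / x * y} ->
  (forall i, f (b i) = g (b i)) -> f =1 g.
Proof.
move=> fM gM fg; have gB := basis_generates b_basis.
by apply: (generates_eq fM gM gB) => _ [i _ <-].
Qed.

Lemma incl_morph (K : groupType) (f : free_group k -> K) :
  {morph f : x y / x * y} ->
  {morph (fun h : subgroup H => f (incl h)) : x y / x * y}.
Proof. by move=> fM x y; rewrite incl_is_multiplicative fM. Qed.

(** Homomorphisms from H to a group are r-tuples, by their values on the basis; this is the tuple of
    the restriction of [free_hom f]. *)
Definition code (gT : finGroupType) (f : {ffun 'I_k -> gT}) : {ffun 'I_r -> gT} :=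
  [ffun i => free_hom f (incl (b i))].

Hypothesis mpH : measure_preserving H.

(** Measure preservation gives all codes the same number N of preimages, and counting all [f] gives
    |G|^k = |G|^r N. The identity is multiplied out to stay in the natural numbers. *)
Lemma card_code (gT : finGroupType) (Q : {set {ffun 'I_r -> gT}}) :
  (#|[set f : {ffun 'I_k -> gT} | code f \in Q]| * #|gT| ^ r = #|Q| * #|gT| ^ k)%N.
Proof.
have [/(_ _)XH unif] := mpH gT.
have /choice[phi phiE] : forall c : {ffun 'I_r -> gT}, exists g : subgroup H -> gT,
    {morph g : x y / x * y} /\ forall i, g (b i) = c i.
  by move=> c; have [g gM gE] := basis_ext c; exists g.
have phiP (f : {ffun 'I_k -> gT}) c : `[< (fun h => free_hom f (incl h)) = phi c >] = (code f == c).
  have [pM pE] := phiE c; apply/asboolP/eqP => [E|<-].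
    by apply/ffunP => i; rewrite ffunE -pE -E.
  apply/funext; apply: basis_eq; first exact: XH.
    by case: (phiE (code f)).
  by move=> i; have [_ ->] := phiE (code f); rewrite ffunE.
pose N := #|[set f : {ffun 'I_k -> gT} | code f == [ffun=> 1]]|.
have cP c : #|[set f : {ffun 'I_k -> gT} | code f == c]| =
    #|[pred f : {ffun 'I_k -> gT} | `[< (fun h : subgroup H => free_hom f (incl h)) = phi c >]]|.
  by rewrite cardsE; apply: eq_card => f; rewrite !inE phiP.
have cN c : #|[set f : {ffun 'I_k -> gT} | code f == c]| = N.
  by rewrite /N !cP; apply: unif; [case: (phiE c)|case: (phiE [ffun=> 1])].
have cQ (Q' : {set {ffun 'I_r -> gT}}) :
    #|[set f : {ffun 'I_k -> gT} | code f \in Q']| = (#|Q'| * N)%N.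
  rewrite -sum1dep_card (partition_big (@code gT) (mem Q')) //= -sum_nat_const.
  apply: eq_bigr => c cQ'; rewrite -(cN c) -sum1dep_card; apply: eq_bigl => f.
  by case: eqVneq => [->|]; rewrite ?andbF ?andbT.
have kE : (#|gT| ^ k = #|gT| ^ r * N)%N.
  have := cQ [set _ | true].
  have cT (aT : finType) : #|[set _ : aT | true]| = #|aT| by rewrite cardsE.
  rewrite (_ : [set f | _] = [set _ | true]); last by apply/setP => f; rewrite !inE.
  by rewrite !cT !card_ffun !card_ord.
by rewrite cQ kE mulnAC mulnA.
Qed.

(** With n = |T|, (n-1)!^r of the n!^r codes fix a given point [i], so by [card_code] a proportion
    n^(-r) of all [f] let H fix [i]; then sum over [i]. *)
Lemma card_fixed_pairs (T : finType) :
  (#|[set x : {ffun 'I_k -> {perm T}} * T |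
      `[< forall h : subgroup H, free_hom x.1 (incl h) x.2 = x.2 >]]| * #|T| ^ r
   = #|T| * (#|T|)`! ^ k)%N.
Proof.
set X := [set x | _].
pose A i := [set f : {ffun 'I_k -> {perm T}} | code f \in
  [set c : {ffun 'I_r -> {perm T}} | [forall j, c j i == i]]].
have cA i : (#|A i| * #|T| ^ r = (#|T|)`! ^ k)%N.
  have T0 : 0 < #|T| by apply/card_gt0P; exists i.
  have := card_code [set c : {ffun 'I_r -> {perm T}} | [forall j, c j i == i]].
  have -> : #|[set c : {ffun 'I_r -> {perm T}} | [forall j, c j i == i]]| = ((#|T|.-1)`! ^ r)%N.
    have -> : [set c : {ffun 'I_r -> {perm T}} | [forall j, c j i == i]] =
        [set c in ffun_on [set s : {perm T} | [forall x in [set i], s x == x]]].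
      apply/setP => c; rewrite !inE; apply/forallP/ffun_onP => cj j.
        by rewrite inE; apply/'forall_implyP => x /set1P ->; exact: cj.
      by have := cj j; rewrite inE => /'forall_implyP; apply; rewrite inE.
    rewrite cardsE card_ffun_on card_ord (@card_perm_extension T [set i] id) ?cards1 ?subn1 //.
  have cp : #|{perm T}| = (#|T|)`!.
    have := @card_perm_extension T finset.set0 id; rewrite cards0 subn0 => <-.
      by rewrite cardsE; apply: eq_card => s; rewrite !inE; apply/esym/forallP => x; rewrite inE.
    by move=> x y; rewrite inE.
  rewrite cp -/(A i). case: #|T| T0 => // n _ /=; rewrite factS !expnMn => E.
  have f0 : 0 < n`! ^ r by rewrite expn_gt0 fact_gt0.
  by apply/eqP; rewrite -(eqn_pmul2r f0) -mulnA E mulnC.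
have -> : #|X| = \sum_(i : T) #|A i|.
  rewrite -sum1_card (partition_big snd predT) //=; apply: eq_bigr => i _.
  rewrite -sum1_card; symmetry.
  rewrite (reindex_onto (fun f => (f, i)) fst) /=; last first.
    by case=> f j /andP[_ /eqP /= ->].
  apply: eq_bigl => f; rewrite !eqxx !andbT !inE /=.
  apply/forallP/asboolP => fi.
    have fM := @free_hom_is_multiplicative _ _ f.
    apply: (generates_ind (basis_generates b_basis)).
    - by rewrite (morph_one (incl_morph fM)) perm1.
    - by move=> x y xi yi; rewrite incl_is_multiplicative fM permM xi.
    - move=> x xi; rewrite (morph_inv (incl_morph fM)).
      by rewrite -{1}xi permK.
    - by move=> _ [j _ <-]; have := fi j; rewrite ffunE => /eqP.
  by move=> j; rewrite ffunE fi.
by rewrite big_distrl /= (eq_bigr _ (fun i _ => cA i)) sum_nat_const.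
Qed.
End Code.

Lemma card_imset_eq (V T U : finType) (f : V -> T) (g : V -> U) (A : {set V}) :
  {in A &, forall u v, (f u == f v) = (g u == g v)} -> #|f @: A| = #|g @: A|.
Proof.
have aux (T' U' : finType) (f' : V -> T') (g' : V -> U') :
    {in A &, forall u v, (f' u == f' v) = (g' u == g' v)} -> #|f' @: A| <= #|g' @: A|.
  move=> fg; pose s y := [pick v in A | f' v == y].
  have SI : injective (@Some U') by move=> ? ? [].
  rewrite -(card_imset (g' @: A) SI).
  apply: (@card_pred_le _ _ _ _ (fun y => omap g' (s y))) => [x y|x] /imsetP[u uA ->].
    move=> /imsetP[v vA ->]; rewrite /s.
    case: pickP => [u' /andP[u'A /eqP <-]|/(_ u)]; last by rewrite uA eqxx.
    case: pickP => [v' /andP[v'A /eqP <-] /SI /eqP|/(_ v)]; last by rewrite vA eqxx.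
    by rewrite -fg // => /eqP.
  rewrite /s; case: pickP => [u' /andP[u'A _]|/(_ u)]; last by rewrite uA eqxx.
  by apply/imset_f/imset_f.
by move=> fg; apply/eqP; rewrite eqn_leq !aux // => u v uA vA; rewrite fg.
Qed.

(** * Congruences and equivariant maps *)

Section Congruences.
Variables (k : nat) (V : finType) (step : letter k -> V -> option V).

(* The congruences are the partitions of the vertices whose quotient is again
   deterministic; nclass and nedge count its vertices and its edges of label j. *)
Definition congruence (p : {set V * V}) : Prop :=
  [/\ forall v, (v, v) \in p, forall u v, (u, v) \in p -> (v, u) \in p,
      forall u v w, (u, v) \in p -> (v, w) \in p -> (u, w) \in p &
      forall a u v u' v', (u, v) \in p -> step a u = Some u' -> step a v = Some v' ->
        (u', v') \in p].

Definition class_rep (p : {set V * V}) v := odflt v [pick u | (v, u) \in p].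

Lemma class_rep_in p v : congruence p -> (v, class_rep p v) \in p.
Proof. by case=> pr _ _ _; rewrite /class_rep; case: pickP => //=. Qed.

Lemma class_rep_eq p u v : congruence p -> (class_rep p u == class_rep p v) = ((u, v) \in p).
Proof.
move=> cp; have [pr ps pt _] := cp; apply/eqP/idP => [E|uv].
  by apply: pt (class_rep_in u cp) _; rewrite E; apply/ps/class_rep_in.
rewrite /class_rep (@eq_pick _ _ (fun w => (v, w) \in p)).
  by case: pickP => //= /(_ v); rewrite pr.
by move=> w; apply/idP/idP; [apply: pt (ps _ _ uv)|apply: pt uv].
Qed.

Lemma class_repK p v : congruence p -> class_rep p (class_rep p v) = class_rep p v.
Proof.
move=> cp; have [_ ps _ _] := cp.
by apply/eqP; rewrite class_rep_eq // ps ?class_rep_in.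
Qed.

Definition source (j : 'I_k) : {set V} := [set v | step (j, false) v].

Definition nclass p : nat := #|class_rep p @: [set v : V | true]|.
Definition nedge p j : nat := #|class_rep p @: source j|.

Definition kernel (T : finType) (phi : V -> T) : {set V * V} :=
  [set x | phi x.1 == phi x.2].

Section Count.
Variables (T : finType).
Implicit Types (phi : {ffun V -> T}) (j : 'I_k).

Definition edge_perms (phi : {ffun V -> T}) (j : 'I_k) : {set {perm T}} :=
  [set s : {perm T} | [forall v, forall w,
     (step (j, false) v == Some w) ==> (s (phi v) == phi w)]].

Hypothesis stepV : step_inv step.

Lemma edge_permsP phi j (s : {perm T}) :
  reflect (forall v w, step (j, false) v = Some w -> s (phi v) = phi w) (s \in edge_perms phi j).
Proof.
rewrite inE; apply: (iffP 'forall_'forall_implyP) => H v w; first by move/eqP/H/eqP.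
by move/eqP/H/eqP.
Qed.

(** Such a permutation is prescribed exactly on the image under [phi] of the sources of edges
    labelled [j]. Compatibility of the kernel with the letter makes the prescription [g] well
    defined, compatibility with its inverse makes it injective. *)
Lemma card_edge_perms phi j : congruence (kernel phi) ->
  #|edge_perms phi j| = (#|T| - nedge (kernel phi) j)`!.
Proof.
move=> ck; have [_ _ _ comp] := ck.
have -> : nedge (kernel phi) j = #|phi @: source j|.
  apply: card_imset_eq => u v _ _.
  by rewrite class_rep_eq // inE.
pose g x := if [pick v | (phi v == x) && step (j, false) v] is Some v
  then (if step (j, false) v is Some w then phi w else x) else x.
have gE v w : step (j, false) v = Some w -> g (phi v) = phi w.
  move=> vw; rewrite /g; case: pickP => [u /andP[/eqP uv]|/(_ v)]; last by rewrite vw eqxx.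
  case E: (step _ u) => [u'|] // _; apply/eqP.
  by have := comp (j, false) u v u' w _ E vw; rewrite !inE /= => ->; rewrite ?uv.
rewrite -(@card_perm_extension T _ g).
  apply: eq_card => s; apply/edge_permsP/idP => [H|].
    rewrite inE; apply/'forall_implyP => _ /imsetP[v + ->]; rewrite inE.
    by case E: (step _ v) => [w|] // _; rewrite (H _ _ E) (gE _ _ E).
  rewrite inE => /'forall_implyP H v w E; rewrite -(gE _ _ E); apply/eqP/H.
  by apply/imsetP; exists v; rewrite // inE E.
move=> _ _ /imsetP[u + ->] /imsetP[v + ->]; rewrite !inE.
case Eu: (step _ u) => [u'|] // _; case Ev: (step _ v) => [v'|] // _.
rewrite (gE _ _ Eu) (gE _ _ Ev) => /eqP E; apply/eqP.
have := comp (j, true) u' v' u v; rewrite !inE /=; apply=> //.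
  exact: (stepV (a := (j, false))).
exact: (stepV (a := (j, false))).
Qed.

Lemma edge_perms_congruence phi (f : 'I_k -> {perm T}) :
  (forall j, f j \in edge_perms phi j) -> congruence (kernel phi).
Proof.
move=> fE; split=> [v|u v|u v w|[j c] u v u' v']; rewrite !inE //=.
- by rewrite eq_sym.
- by move=> /eqP ->.
move=> /eqP uv; case: c => Eu Ev.
  have /edge_permsP H := fE j; have := H _ _ (stepV Eu); rewrite uv.
  by rewrite -(H _ _ (stepV Ev)) => /(@perm_inj _ (f j)) ->.
by have /edge_permsP H := fE j; rewrite -(H _ _ Eu) -(H _ _ Ev) uv.
Qed.

(** Maps with kernel [p] are the injections into [T] of the set [D] of class representatives. *)
Lemma card_kernel p : congruence p ->
  #|[set phi : {ffun V -> T} | kernel phi == p]| = #|T| ^_ (nclass p).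
Proof.
move=> cp; pose D := {v : V | v \in class_rep p @: [set v : V | true]}.
have -> : nclass p = #|{: D}| by rewrite card_sig; apply: eq_card.
rewrite -card_inj_ffuns.
have inD v : class_rep p v \in class_rep p @: [set v : V | true].
  by apply: imset_f; rewrite inE.
have Drep (x : D) : class_rep p (val x) = val x.
  by have /imsetP[v _ ->] := valP x; rewrite class_repK.
pose R (phi : {ffun V -> T}) : {ffun D -> T} := [ffun x => phi (val x)].
pose E (g : {ffun D -> T}) : {ffun V -> T} := [ffun v => g (Sub (class_rep p v) (inD v))].
have EK g : R (E g) = g.
  by apply/ffunP => x; rewrite !ffunE; congr (g _); apply/val_inj => /=; rewrite Drep.
have -> : [set phi : {ffun V -> T} | kernel phi == p] =
    E @: [set g : {ffun D -> T} | injectiveb g].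
  apply/setP => phi; rewrite inE; apply/eqP/imsetP => [ph|[g + ->]].
    have pE u v : ((u, v) \in p) = (phi u == phi v) by rewrite -ph inE.
    exists (R phi).
      rewrite inE; apply/injectiveP => x y; rewrite !ffunE => /eqP xy.
      have : (val x, val y) \in p by rewrite pE.
      by rewrite -class_rep_eq // !Drep => /eqP /val_inj.
    apply/ffunP => v; rewrite !ffunE /=; apply/eqP.
    by have := class_rep_in v cp; rewrite pE.
  rewrite inE => /injectiveP gI; apply/setP => -[u v]; rewrite inE /= !ffunE.
  rewrite (inj_eq gI) -class_rep_eq //.
by rewrite card_imset //; exact: can_inj EK.
Qed.

(** Sort the pairs by the kernel of the map, necessarily a congruence; once the map is chosen, the
    permutations are chosen independently for each generator. *)
Lemma card_equivariant :
  #|[set x : {ffun 'I_k -> {perm T}} * {ffun V -> T} | [forall j, x.1 j \in edge_perms x.2 j]]|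
  = \sum_(p : {set V * V} | `[< congruence p >]) #|T| ^_ (nclass p) * \prod_j (#|T| - nedge p j)`!.
Proof.
set Y := [set x | _].
have -> : #|Y| = \sum_(phi : {ffun V -> T} | `[< congruence (kernel phi) >])
    \prod_j (#|T| - nedge (kernel phi) j)`!.
  rewrite -sum1_card (partition_big snd (fun phi => `[< congruence (kernel phi) >])) /=.
    apply: eq_bigr => phi /asboolP cphi.
    rewrite (eq_bigr (fun j => #|edge_perms phi j|)); last first.
      by move=> j _; rewrite card_edge_perms.
    transitivity #|family (fun j => edge_perms phi j)|; last first.
      by rewrite card_family /image_mem foldrE big_map enumT.
    rewrite -sum1_card (reindex_onto (fun f => (f, phi)) fst) /=; last first.
      by case=> f j /andP[_ /eqP /= ->].
    apply: eq_bigl => f; rewrite !eqxx !andbT inE /=.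
    by apply/forallP/familyP.
  by move=> [f phi]; rewrite inE => /forallP /edge_perms_congruence ?; apply/asboolP.
rewrite (partition_big (fun phi : {ffun V -> T} => kernel phi) (fun p => `[< congruence p >])) //=.
apply: eq_bigr => p cp; rewrite -card_kernel; last exact/asboolP.
rewrite -sum_nat_const; apply: eq_big => [phi|phi /andP[_ /eqP ->] //].
by rewrite inE; case: eqVneq => [->|]; rewrite ?andbF ?andbT.
Qed.

End Count.
End Congruences.

Definition presents k (V : finType) (step : letter k -> V -> option V) (v0 : V)
    (H : groupClosed (free_group k)) : Prop :=
  [/\ step_inv step, forall x, x \in H <-> reads step v0 x v0 &
      forall v, exists x, reads step v0 x v].

Section Presentation.
Variables (k r : nat) (H : groupClosed (free_group k)).
Variable b : 'I_r -> subgroup H.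
Hypothesis b_basis : basis (range b).

(** In the piece of the Schreier graph along the words of a basis, these words are loops at the base
    vertex; what loops read is closed under products and inverses, hence all of H is read. *)
Lemma presentation_exists : exists (V : finType) (step : letter k -> V -> option V) (v0 : V),
  presents step v0 H.
Proof.
have [V [step [v0 [stV stH stL stC]]]] := schreier_graph H [seq incl (b i) | i <- enum 'I_r].
exists V, step, v0; split=> // x; split=> [xH|R]; last by rewrite (stH _ _ R) eqxx.
rewrite -[x]/(incl (exist _ x xH : subgroup H)).
move: (exist _ x xH : subgroup H).
apply: (generates_ind (P := fun h => reads step v0 (incl h) v0) (basis_generates b_basis)).
- by [].
- move=> y z yR zR; rewrite incl_is_multiplicative. exact: (readsM stV yR zR).
- by move=> y yR; rewrite (morph_inv (@incl_is_multiplicative _ H)); exact: (readsV stV).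
- move=> _ [i _ <-]; have [|v R] := stL (incl (b i)); first by apply: map_f; rewrite mem_enum.
  have bH : incl (b i) \in H := valP (b i).
  by move: (R); have := stH _ _ R; rewrite bH => /esym /eqP ->.
Qed.

Variables (V : finType) (step : letter k -> V -> option V) (v0 : V).
Hypothesis pres : presents step v0 H.
Hypothesis b_inj : injective b.
Hypothesis mpH : measure_preserving H.

(** A common fixed point [i] of H determines the equivariant map sending [v] to the image of [i]
    under any path from [v0] to [v], as two such paths differ by an element of H. Conversely,
    evaluate the map at [v0]. *)
Lemma card_fixed_equivariant (T : finType) :
  #|[set x : {ffun 'I_k -> {perm T}} * T |
      `[< forall h : subgroup H, free_hom x.1 (incl h) x.2 = x.2 >]]| =
  #|[set x : {ffun 'I_k -> {perm T}} * {ffun V -> T} | [forall j, x.1 j \in edge_perms step x.2 j]]|.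
Proof.
have [stV stH stC] := pres.
set X := [set x | _]; set Y := [set x | _].
have YP f phi : (f, phi) \in Y ->
    forall v x w, reads step v x w -> free_hom f x (phi v) = phi w.
  rewrite inE => /forallP fE; apply: reads_perm => // j v w.
  by have /edge_permsP := fE j; apply.
have -> : X = (fun x : _ * {ffun V -> T} => (x.1, x.2 v0)) @: Y.
  apply/setP => -[f i]; apply/idP/imsetP => [|[[f' phi] fY [-> ->]]]; last first.
    by rewrite inE /=; apply/asboolP => h; apply: (YP _ _ fY); apply/stH; exact: (valP h).
  rewrite inE /= => /asboolP Hi; have /choice[a aE] := stC.
  pose phi : {ffun V -> T} := [ffun v => free_hom f (a v) i].
  have fM := @free_hom_is_multiplicative _ _ f.
  have fixH x y v : reads step v0 x v -> reads step v0 y v -> free_hom f x i = free_hom f y i.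
    move=> xv yv; have xyH : x * y^-1 \in H by apply/stH/(readsM stV xv)/readsV.
    have /= E := Hi (exist (fun z => z \in H) _ xyH).
    by rewrite -(mulgVK y x) fM permM E.
  exists (f, phi); last by rewrite /= ffunE -(fixH 1 (a v0) v0) // (morph_one fM) perm1.
  rewrite inE /=; apply/forallP => j; apply/edge_permsP => v w vw.
  rewrite !ffunE -permM -free_hom_gen -fM; apply: (fixH _ _ w) => //.
  by apply: (readsM stV (aE v)); exact: (reads_elt vw).
rewrite card_in_imset // => -[f phi] [f' phi'] /= fY fY' [ff vv].
subst f'; congr (_, _); apply/ffunP => v; have [x xv] := stC v.
by rewrite -(YP _ _ fY _ _ _ xv) -(YP _ _ fY' _ _ _ xv) vv.
Qed.

(** Both sides count actions on [T] with a common fixed point of H, times n^r: once through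
    equivariant maps, once through uniformity. *)
Lemma congruence_sum (T : finType) :
  (\sum_(p : {set V * V} | `[< congruence step p >])
     #|T| ^_ (nclass p) * \prod_j (#|T| - nedge step p j)`! * #|T| ^ r
   = #|T| * (#|T|)`! ^ k)%N.
Proof.
have [stV _ _] := pres.
rewrite -(card_fixed_pairs b_inj b_basis mpH) card_fixed_equivariant card_equivariant //.
by rewrite big_distrl.
Qed.
End Presentation.

(** * The two leading coefficients *)

Section MonicSums.
Import GRing.Theory Num.Theory Order.TTheory.
Local Open Scope ring_scope.

(** Each count is a product of factors n - i. The list of the i becomes the roots of a monic
    polynomial: its length is the degree, minus its sum the second coefficient. *)
Let pol (s : seq nat) : {poly int} := \prod_(z <- [seq i%:R | i <- s]) ('X - z%:P).

Let size_pol s : size (pol s) = (size s).+1.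
Proof. by rewrite size_prod_XsubC size_map. Qed.

Let coef_lead s : (pol s)`_(size s) = 1.
Proof.
have /monicP := monic_prod_XsubC [seq i%:R : int | i <- s] xpredT id.
by rewrite lead_coefE size_prod_XsubC size_map.
Qed.

Let coef_second s m : size s = m.+1 -> (pol s)`_m = - (sumn s)%:R.
Proof.
move=> sm; have := @coefPn_prod_XsubC int [seq i%:R | i <- s].
rewrite size_map sm => -> //; rewrite big_map sumnE; congr (- _).
by rewrite natr_sum.
Qed.

Let horner_pol s n : (forall i, i \in s -> i <= n)%N ->
  (pol s).[n%:R] = (\prod_(i <- s) (n - i))%N%:R.
Proof.
move=> sn; rewrite horner_prod big_map natr_prod [LHS]big_seq [RHS]big_seq.
by apply: eq_bigr => i /sn le_in; rewrite hornerXsubC natrB.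
Qed.

Variables (I : finType) (C : pred I) (s : I -> seq nat) (t : seq nat) (N : nat).
Hypothesis s_le : forall p i, i \in s p -> (i <= N)%N.
Hypothesis t_le : forall i, i \in t -> (i <= N)%N.
Hypothesis sum_eq : forall n, (N < n)%N ->
  (\sum_(p | C p) \prod_(i <- s p) (n - i) = \prod_(i <- t) (n - i))%N.

Let pol_eq : \sum_(p | C p) pol (s p) = pol t.
Proof.
apply/eqP; rewrite -subr_eq0; apply/eqP; set d := _ - _.
(* As many roots beyond [N] as the size of [d] force [d] to vanish. *)
pose rs : seq int := [seq (N.+1 + i)%:R | i <- iota 0 (size d)].
apply: (@roots_geq_poly_eq0 _ d rs); last by rewrite size_map size_iota.
  apply/allP => _ /mapP[i _ ->]; rewrite rootE /d !hornerE horner_sum.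
  rewrite horner_pol => [|j /t_le jN]; last by rewrite (leq_trans jN) // addSn leqW ?leq_addr.
  rewrite -sum_eq ?addSn ?ltnS ?leq_addr // natr_sum subr_eq0; apply/eqP/eq_bigr => p _.
  by rewrite horner_pol // => j /s_le jN; rewrite (leq_trans jN) // leqW ?leq_addr.
rewrite map_inj_uniq ?iota_uniq // => i j /eqP.
by rewrite eqr_nat eqn_add2l => /eqP.
Qed.

Let coef_eq m : \sum_(p | C p) (pol (s p))`_m = (pol t)`_m.
Proof. by rewrite -coef_sum pol_eq. Qed.

Let coef_max m : (forall p, C p -> size (s p) <= m)%N ->
  (pol t)`_m = #|[pred p | C p && (size (s p) == m)]|%:R.
Proof.
move=> sm; rewrite -coef_eq -sum1_card natr_sum big_mkcondr /=.
apply: eq_bigr => p Cp; case: eqVneq => [<-|ne]; first by rewrite coef_lead.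
by rewrite nth_default // size_pol ltn_neqAle ne sm.
Qed.

(** Monic polynomials cannot cancel in top degree: the coefficient there is the positive number of
    summands reaching it. *)
Lemma size_le_of_monic_sum p : C p -> (size (s p) <= size t)%N.
Proof.
move=> Cp; rewrite leqNgt; apply/negP => lt_tp.
case: (arg_maxnP (fun q => size (s q)) Cp) => q Cq qmax.
have := @coef_max (size (s q)) qmax.
rewrite nth_default; last by rewrite size_pol; apply: leq_trans lt_tp (qmax p Cp).
move/esym/eqP; rewrite pnatr_eq0 => /eqP/card0_eq/(_ q).
by rewrite !inE Cq eqxx.
Qed.

Variable i0 : I.
Hypotheses (Ci0 : C i0) (size_i0 : size (s i0) = size t).

(** The leading coefficient of [pol t] is 1, so [i0] is the only summand of top degree. *)
Lemma size_lt_of_monic_sum p : C p -> p != i0 -> (size (s p) < size t)%N.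
Proof.
move=> Cp pi0; rewrite ltn_neqAle size_le_of_monic_sum // andbT; apply/negP => sp.
have := @coef_max (size t) size_le_of_monic_sum; rewrite coef_lead => /eqP.
rewrite eq_sym (eqr_nat _ _ 1) => /eqP E.
have := @subset_leq_card _ (mem [:: p; i0]) [pred p | C p && (size (s p) == size t)].
have /card_uniqP -> : uniq [:: p; i0] by rewrite /= inE pi0.
rewrite E => H; suff : (2 <= 1)%N by []; apply: H.
by apply/fintype.subsetP => q; rewrite !inE => /orP[] /eqP ->; rewrite ?Cp ?sp ?Ci0 ?size_i0 ?eqxx.
Qed.

(** In the second coefficient, [i0] contributes minus the sum of its roots and each summand of
    degree one less contributes its leading coefficient 1. *)
Lemma second_coef_of_monic_sum : (0 < size t)%N ->
  (#|[pred p | C p && ((size (s p)).+1 == size t)]| + sumn t = sumn (s i0))%N.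
Proof.
case st : (size t) => [//|m] _.
have := coef_eq m; rewrite (coef_second st) (bigD1 i0) //= (coef_second (_ : size (s i0) = m.+1)).
  rewrite (eq_bigr (fun p => if size (s p) == m then 1 else 0)); last first.
    move=> p /andP[Cp /(size_lt_of_monic_sum Cp)]; rewrite st ltnS => le_pm.
    case: eqVneq => [<-|ne]; first by rewrite coef_lead.
    by rewrite nth_default // size_pol ltn_neqAle ne.
  rewrite -big_mkcondr /= => E.
  have -> : #|[pred p | C p && ((size (s p)).+1 == m.+1)]| =
      (\sum_(i | C i && (i != i0) && (size (s i) == m)) 1)%N.
    rewrite -sum1_card; apply: eq_bigl => p; rewrite !inE eqSS.
    by case: (eqVneq p i0) => [->|_]; rewrite ?andbT // size_i0 st andbF /= andbC gtn_eqF.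
  apply/eqP; rewrite -(eqr_nat int) natrD natr_sum.
  by apply/eqP/(addrI (- (sumn (s i0))%:R)); rewrite addrA E !addNr.
by rewrite size_i0.
Qed.
End MonicSums.

Lemma sumn_iota m n : sumn (iota m n) + 'C(m, 2) = 'C(m + n, 2).
Proof.
elim: n m => [|n IH] m; first by rewrite addn0.
rewrite -addSnnS -IH /= binS bin1; lia.
Qed.

Lemma prod_iota n m d : (\prod_(i <- iota m d) (n - i) = (n - m) ^_ d)%N.
Proof.
elim: d m => [|d IH] m; first by rewrite big_nil ffactn0.
by rewrite /= big_cons IH ffactnS subnS.
Qed.

(** * Euler characteristics of the quotients *)

Section Ranks.
Variables (k r : nat) (H : groupClosed (free_group k)).
Variable b : 'I_r -> subgroup H.
Hypothesis b_basis : basis (range b).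
Hypothesis b_inj : injective b.
Variables (V : finType) (step : letter k -> V -> option V) (v0 : V).
Hypothesis pres : presents step v0 H.

Definition diag : {set V * V} := [set x | x.1 == x.2].

Lemma congruence_diag : congruence step diag.
Proof.
split=> [v|u v|u v w|a u v u' v']; rewrite !inE //=; first by rewrite eq_sym.
  by move=> /eqP ->.
by move=> /eqP -> -> [->].
Qed.

Lemma class_rep_diag v : class_rep diag v = v.
Proof. by have := class_rep_in v congruence_diag; rewrite inE => /eqP. Qed.

Lemma card_class_rep_diag (A : {set V}) : #|class_rep diag @: A| = #|A|.
Proof. by apply: card_imset => u v; rewrite !class_rep_diag. Qed.

Lemma nclass_diag : nclass diag = #|V|.
Proof. by rewrite /nclass card_class_rep_diag cardsE. Qed.

Lemma nedge_diag j : nedge step diag j = #|source step j|.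
Proof. exact: card_class_rep_diag. Qed.

Definition edges (p : {set V * V}) : nat := \sum_j nedge step p j.

Lemma nclass_le (p : {set V * V}) : nclass p <= #|V|.
Proof. by apply: leq_trans (leq_imset_card _ _) (max_card _). Qed.

Lemma nedge_le (p : {set V * V}) j : nedge step p j <= #|V|.
Proof. exact: leq_trans (leq_imset_card _ _) (max_card _). Qed.

Hypothesis mpH : measure_preserving H.

Let N := #|V|.
(** Dividing [congruence_sum] by (n - N)!^k turns both sides into products of factors n - i: the
    term of [p] is n^r n^_c prod_j (n - e_j)^_(N - e_j), with c classes and e_j edges labelled j,
    and the right side is n (n^_N)^k. [s p] and [t] list the i. *)
Let s p := nseq r 0 ++ iota 0 (nclass p) ++
  flatten [seq iota (nedge step p j) (N - nedge step p j) | j <- enum 'I_k].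
Let t := 0 :: flatten [seq iota 0 N | j <- enum 'I_k].

Let size_s p : (size (s p) + edges p = r + nclass p + k * N)%N.
Proof.
rewrite !size_cat size_nseq size_iota size_flatten /shape -map_comp sumnE big_map big_enum /=.
rewrite (eq_bigr (fun j => N - nedge step p j)); last by move=> j _; rewrite size_iota.
rewrite -!addnA -big_split /= (eq_bigr (fun=> N)); last by move=> j _; rewrite subnK ?nedge_le.
by rewrite sum_nat_const card_ord.
Qed.

Let size_t : size t = (1 + k * N)%N.
Proof.
rewrite /= size_flatten /shape -map_comp sumnE big_map big_enum /=.
rewrite (eq_bigr (fun j => N)); last by move=> j _; rewrite size_iota.
by rewrite sum_nat_const card_ord.
Qed.

Let s_le p i : i \in s p -> i <= N.
Proof.
rewrite !mem_cat => /orP[/nseqP[-> //]|/orP[|/flattenP[_ /mapP[j _ ->]]]].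
  by rewrite mem_iota add0n /= => /ltnW; move/leq_trans; apply; apply: nclass_le.
by rewrite mem_iota subnKC ?nedge_le // => /andP[_ /ltnW].
Qed.

Let t_le i : i \in t -> i <= N.
Proof.
rewrite inE => /orP[/eqP -> //|/flattenP[_ /mapP[j _ ->]]].
by rewrite mem_iota => /andP[_ /ltnW].
Qed.

Let prod_flatten (F : 'I_k -> seq nat) n :
  (\prod_(i <- flatten [seq F j | j <- enum 'I_k]) (n - i)
  = \prod_(j < k) \prod_(i <- F j) (n - i))%N.
Proof. by rewrite big_flatten big_map big_enum. Qed.

Let sum_eq n : N < n ->
  (\sum_(p | `[< congruence step p >]) \prod_(i <- s p) (n - i) = \prod_(i <- t) (n - i))%N.
Proof.
move=> /ltnW Nn; have := congruence_sum b_basis pres b_inj mpH 'I_n; rewrite card_ord.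
have f0 : 0 < (n - N)`! ^ k by rewrite expn_gt0 fact_gt0.
move=> E; apply/eqP; rewrite -(eqn_pmul2r f0); apply/eqP.
rewrite [t]lock /= -lock big_cons subn0 prod_flatten.
have -> : (\prod_(j < k) \prod_(i <- iota 0 N) (n - i) = (n ^_ N) ^ k)%N.
  transitivity (\prod_(j < k) (n ^_ N))%N.
    by apply: eq_bigr => j _; rewrite prod_iota subn0.
  by rewrite prod_nat_const card_ord.
rewrite -mulnA -expnMn ffact_fact // -E !big_distrl /=.
apply: eq_bigr => p _; rewrite !big_cat /= big_nseq prod_flatten prod_iota !subn0.
have -> : iter r (muln n) 1%N = (n ^ r)%N by elim: (r) => //= m ->; rewrite expnS.
rewrite -!mulnA; set P := (\prod_(j < k) \prod_(i <- _) _)%N; set Q := (\prod_j _)%N.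
suff -> : (P * (n - N)`! ^ k = Q)%N by rewrite mulnC mulnA.
transitivity (\prod_(j < k) ((n - nedge step p j) ^_ (N - nedge step p j) * (n - N)`!))%N.
  rewrite big_split /= prod_nat_const card_ord; congr (_ * _)%N.
  by apply: eq_bigr => j _ /=; rewrite prod_iota.
apply: eq_bigr => j _; have le_jN := nedge_le p j.
have -> : (n - N = n - nedge step p j - (N - nedge step p j))%N.
  by move: le_jN Nn; rewrite /N; lia.
by rewrite ffact_fact // leq_sub2r.
Qed.

(** Comparison of degrees: the Euler characteristic of a quotient is at most 1 - r. *)
Lemma congruence_rank p : congruence step p -> (r + nclass p <= 1 + edges p)%N.
Proof.
move=> /asboolP cp; have := size_le_of_monic_sum s_le t_le sum_eq cp.
by move: (size_s p); rewrite size_t; lia.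
Qed.

Hypothesis diag_rank : (1 + edges diag <= r + nclass diag)%N.

Let size_diag : size (s diag) = size t.
Proof.
have := congruence_rank congruence_diag; have := size_s diag.
by move: diag_rank; rewrite size_t; lia.
Qed.

Let cdiag : `[< congruence step diag >]. Proof. exact/asboolP/congruence_diag. Qed.

(** By [diag_rank] the trivial congruence attains the top degree, and only one summand can. *)
Lemma nondiag_rank p : congruence step p -> p != diag -> (r + nclass p <= edges p)%N.
Proof.
move=> /asboolP cp pd; have := size_lt_of_monic_sum s_le t_le sum_eq cdiag size_diag cp pd.
by move: (size_s p); rewrite size_t; lia.
Qed.

(** Comparison of second coefficients. The binomials count the edges and the vertices of the graph
    of unordered pairs of distinct vertices, so the congruences counted here number its Euler
    characteristic. *)
Lemma card_corank_one :
  (#|[set p : {set V * V} | `[< congruence step p >] & r + nclass p == edges p]|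
   + \sum_j 'C(#|source step j|, 2) = 'C(#|V|, 2))%N.
Proof.
have t0 : 0 < size t by [].
have := second_coef_of_monic_sum s_le t_le sum_eq cdiag size_diag t0.
have -> : #|[pred p | `[< congruence step p >] & (size (s p)).+1 == size t]| =
  #|[set p : {set V * V} | `[< congruence step p >] & r + nclass p == edges p]|.
  rewrite cardsE; apply: eq_card => p; rewrite !inE; congr (_ && _).
  by apply/eqP/eqP; move: (size_s p); rewrite size_t; lia.
have sumF (F : 'I_k -> seq nat) :
    sumn (flatten [seq F j | j <- enum 'I_k]) = \sum_j sumn (F j).
  by rewrite sumn_flatten -map_comp sumnE big_map big_enum.
have sumI m d : sumn (iota m d) = ('C(m + d, 2) - 'C(m, 2))%N by rewrite -sumn_iota addnK.
rewrite /= sumF !sumn_cat sumF sumn_nseq nclass_diag.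
have -> : (\sum_(j < k) sumn (iota 0 N) =
    \sum_(j < k) sumn (iota (nedge step diag j) (N - nedge step diag j)) +
    \sum_j 'C(#|source step j|, 2))%N.
  rewrite -big_split; apply: eq_bigr => j _ /=.
  rewrite -nedge_diag sumn_iota subnKC ?nedge_le //.
  by have := sumn_iota 0 N; rewrite add0n addn0.
have := sumn_iota 0 N; rewrite add0n addn0 /N => <-.
rewrite mul0n !add0n; set X := (\sum_j sumn _)%N; set Z := (\sum_j 'C(_, _))%N.
by lia.
Qed.
End Ranks.

(** * Labellings of quotient graphs *)

Section FreeHomInj.

(** By residual finiteness a nontrivial [t] in the kernel would survive under some [free_hom f] to a
    finite group, but [free_hom f] factors through [free_hom c] by [D]. *)
Lemma free_hom_inj k m (c : 'I_m -> free_group k) :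
  (forall (gT : finGroupType) (f : 'I_m -> gT),
     exists (J : groupClosed (free_group k)) (D : free_group k -> gT),
       {in J &, {morph D : x y / x * y}} /\
       forall i, c i \in J /\ D (c i) = f i) ->
  injective (free_hom c).
Proof.
move=> ext.
have fM := @free_hom_is_multiplicative _ _ c.
suff ker t : free_hom c t = 1 -> t = 1.
  move=> x y xy; apply: (mulIg y^-1); rewrite mulgV; apply: ker.
  by rewrite fM xy (morph_inv fM) mulgV.
move=> t1; apply: contrapT => /free_group_residually_finite[gT [f ft]].
have [J [D [DM Dc]]] := ext gT f; apply: ft.
have D1 : D 1 = 1 by apply: (mulgI (D 1)); rewrite -DM ?gpred1 // !mulg1.
have DV x : x \in J -> D x^-1 = (D x)^-1.
  by move=> xJ; apply: (mulgI (D x)); rewrite -DM ?gpredV // !mulgV D1.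
suff [_ <-] : free_hom c t \in J /\ D (free_hom c t) = free_hom f t by rewrite t1.
elim/free_group_ind: t {t1} => [|a x [xJ Dx]].
  by rewrite (morph_one fM) (morph_one (@free_hom_is_multiplicative _ _ f)) gpred1.
rewrite fM (@free_hom_is_multiplicative _ _ f) !free_hom_elt.
have [cJ cD] := Dc a.1.
have aJ : eval_letter c a \in J by rewrite /eval_letter; case: a.2; rewrite ?gpredV.
split; first exact: gpredM.
rewrite DM // Dx; congr (_ * _).
by rewrite /eval_letter; case: a.2; rewrite ?DV ?cD.
Qed.

End FreeHomInj.

(* A labelling of the edges of the quotient graph by elements of a finite group
   G makes the product of the labels along a path a cocycle, read off from the
   action of F_k on V * G. A labelling is determined by the products along the
   basis of H, along the pairs generating the congruence, and along one path to
   each vertex other than the base point. Counting labellings bounds the rank of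
   the quotient, and in case of equality shows that the former products can be
   prescribed. *)
Section Labels.
Variables (k r m : nat) (H : groupClosed (free_group k)).
Variable b : 'I_r -> subgroup H.
Hypothesis b_basis : basis (range b).
Variables (V : finType) (step : letter k -> V -> option V) (v0 : V).
Hypothesis pres : presents step v0 H.
Variables (p : {set V * V}) (Q : 'I_m -> V * V) (path : V -> free_group k).
Hypothesis cp : congruence step p.
Hypothesis pathP : forall v, reads step v0 (path v) v.
Hypothesis Qp : forall i, Q i \in p.
Hypothesis p_min : forall q, congruence step q -> (forall i, Q i \in q) ->
  {subset p <= q}.

Let rep := class_rep p.

(** The number of extensions of each partial permutation of the classes is a factorial, hence
    positive. *)
Lemma class_rep_perms : exists sigma : 'I_k -> {perm V},
  forall j v w, step (j, false) v = Some w -> sigma j (rep v) = rep w.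
Proof.
have [stV _ _] := pres; pose phi : {ffun V -> V} := [ffun v => rep v].
have kp : kernel phi = p.
  by apply/setP => -[u v]; rewrite inE !ffunE (class_rep_eq _ _ cp).
have /choice[s sE] : forall j, exists s : {perm V}, s \in edge_perms step phi j.
  move=> j; apply/card_gt0P; rewrite card_edge_perms ?kp //; exact: fact_gt0.
exists s => j v w vw; have /edge_permsP/(_ v w vw) := sE j.
by rewrite !ffunE.
Qed.

Section Cover.
Variables (sigma : 'I_k -> {perm V}) (gT : finGroupType).
Hypothesis sigmaE : forall j v w, step (j, false) v = Some w -> sigma j (rep v) = rep w.

Definition class_edge : Type := {x : 'I_k * V | x.2 \in rep @: source step x.1}.
HB.instance Definition _ := Finite.on class_edge.

Lemma card_class_edge : #|{: class_edge}| = edges step p.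
Proof.
rewrite card_sig -sum1_card (eq_bigl (fun x : 'I_k * V => true && (x.2 \in rep @: source step x.1))).
  rewrite -(pair_big_dep xpredT (fun j v => v \in rep @: source step j) (fun _ _ => 1%N)) /=.
  by apply: eq_bigr => j _; rewrite sum1_card.
by move=> x; rewrite !inE.
Qed.

Section Cocycle.
Variable l : {ffun class_edge -> gT}.

Definition label (j : 'I_k) (c : V) : gT :=
  if (insub (j, c) : option class_edge) is Some e then l e else 1.

(** A skew product over [sigma]: the second coordinate collects the labels along a path. *)
Let shift j (x : V * gT) : V * gT := (sigma j x.1, x.2 * label j x.1).

Let shift_inj j : injective (shift j).
Proof. by move=> [c g] [d h] [/perm_inj <- /mulIg ->]. Qed.

Definition cover_hom : free_group k -> {perm V * gT} :=
  free_hom (fun j => perm (@shift_inj j)).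

Let cM : {morph cover_hom : x y / x * y}.
Proof. exact: free_hom_is_multiplicative. Qed.

Definition cover_end x c : V := (cover_hom x (c, 1)).1.
Definition cover_val x c : gT := (cover_hom x (c, 1)).2.

(** Labels multiply on the right, so the action commutes with left translations of the group
    coordinate and is known from its values at (c, 1). *)
Lemma cover_homE x c g : cover_hom x (c, g) = (cover_end x c, g * cover_val x c).
Proof.
have cg j d h : cover_hom (gen j) (d, h) = (sigma j d, h * label j d).
  by rewrite /cover_hom free_hom_gen permE.
suff [d [y E]] : exists d y, forall h, cover_hom x (c, h) = (d, h * y).
  by rewrite /cover_end /cover_val !E mul1g.
elim/free_group_ind: x c {g} => [|[j e] x IH] c.
  by exists c, 1 => h; rewrite (morph_one cM) perm1 mulg1.
have [d [y E]] : exists d y, forall h, cover_hom (elt (j, e)) (c, h) = (d, h * y).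
  rewrite /elt /eval_letter; case: e => /=; last by exists (sigma j c), (label j c).
  pose d := (sigma j)^-1 c; exists d, (label j d)^-1 => h.
  rewrite (morph_inv cM); apply: (@perm_inj _ (cover_hom (gen j))).
  by rewrite permKV cg /d permKV mulgVK.
have [d' [y' E']] := IH d; exists d', (y * y') => h.
by rewrite cM permM E E' mulgA.
Qed.

Lemma cover_endM x y c : cover_end (x * y) c = cover_end y (cover_end x c).
Proof. by rewrite /cover_end cM permM !cover_homE. Qed.

Lemma cover_valM x y c :
  cover_val (x * y) c = cover_val x c * cover_val y (cover_end x c).
Proof. by rewrite {1}/cover_val cM permM !cover_homE mul1g. Qed.

Lemma cover_end1 c : cover_end 1 c = c.
Proof. by rewrite /cover_end (morph_one cM) perm1. Qed.

Lemma cover_val1 c : cover_val 1 c = 1.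
Proof. by rewrite /cover_val (morph_one cM) perm1. Qed.

Lemma cover_valV x c d : cover_end x c = d -> cover_val x^-1 d = (cover_val x c)^-1.
Proof.
move=> <-; apply: (mulgI (cover_val x c)).
by rewrite -cover_valM !mulgV cover_val1.
Qed.

Lemma cover_endV x c d : cover_end x c = d -> cover_end x^-1 d = c.
Proof. by move=> <-; rewrite -cover_endM mulgV cover_end1. Qed.

Lemma cover_gen j c : cover_val (gen j) c = label j c.
Proof. by rewrite /cover_val /cover_hom free_hom_gen permE /= mul1g. Qed.

Lemma cover_end_reads v x w : reads step v x w -> cover_end x (rep v) = rep w.
Proof.
have [stV _ _] := pres.
elim/reads_ind: v x w / => [v|a v w x z E IH]; first exact: cover_end1.
rewrite cover_endM -IH; congr (cover_end _ _).
have cg j u u' : step (j, false) u = Some u' -> cover_end (gen j) (rep u) = rep u'.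
  by move=> /sigmaE <-; rewrite /cover_end /cover_hom free_hom_gen permE.
case: a E => j [] E; rewrite /elt /eval_letter /=; last exact: cg.
by apply/cover_endV/cg/(stV _ _ _ E).
Qed.

Let c0 := rep v0.

Lemma cover_val_edge j v w : step (j, false) v = Some w ->
  cover_val (path v * gen j * (path w)^-1) c0 =
  cover_val (path v) c0 * label j (rep v) * (cover_val (path w) c0)^-1.
Proof.
move=> vw; rewrite !cover_valM cover_endM (cover_end_reads (pathP v)) cover_gen.
congr (_ * _); apply: cover_valV; rewrite (cover_end_reads (pathP w)).
by rewrite (@cover_end_reads v _ w) //; exact: (@reads_elt _ _ _ (j, false)).
Qed.

Lemma cover_loop_morph :
  {morph (fun h : subgroup H => cover_val (incl h) c0) : x y / x * y}.
Proof.
have [_ stH _] := pres; move=> x y; rewrite incl_is_multiplicative cover_valM.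
by rewrite (@cover_end_reads v0 _ v0) //; apply/stH; exact: (valP x).
Qed.

Definition pair_elt i : free_group k := path (Q i).1 * (path (Q i).2)^-1.

Lemma rep_pair i : rep (Q i).1 = rep (Q i).2.
Proof. by apply/eqP; rewrite (class_rep_eq _ _ cp) //; case: (Q i) (Qp i). Qed.

Lemma cover_end_pair i : cover_end (pair_elt i) c0 = c0.
Proof.
rewrite cover_endM (cover_end_reads (pathP _)) rep_pair.
by apply: cover_endV; rewrite (cover_end_reads (pathP _)).
Qed.

Lemma cover_val_pair i : cover_val (pair_elt i) c0 =
  cover_val (path (Q i).1) c0 * (cover_val (path (Q i).2) c0)^-1.
Proof.
rewrite cover_valM (cover_end_reads (pathP _)); congr (_ * _).
by apply: cover_valV; rewrite (cover_end_reads (pathP _)) rep_pair.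
Qed.

End Cocycle.

Let c0 := rep v0.

(** Let [c v] compare the two products along [path v]. Equality on H relates the two labels of an
    edge through [c] at its ends, so the pairs of [p] with equal [c] form a congruence [K]. It
    contains the generating pairs, hence [p], and [c] is constant on classes. *)
Lemma label_inj (l l' : {ffun class_edge -> gT}) :
  (forall i, cover_val l (incl (b i)) c0 = cover_val l' (incl (b i)) c0) ->
  (forall i, cover_val l (pair_elt i) c0 = cover_val l' (pair_elt i) c0) ->
  (forall v, rep v = v -> v != c0 -> cover_val l (path v) c0 = cover_val l' (path v) c0) ->
  l = l'.
Proof.
have [stV stH _] := pres; have [pr ps pt pc] := cp.
move=> eq_b eq_pair eq_path.
have eqH x : x \in H -> cover_val l x c0 = cover_val l' x c0.
  move=> xH; have := basis_eq b_basis (cover_loop_morph l) (cover_loop_morph l') eq_b.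
  exact: (fun E => E (exist (fun z => z \in H) _ xH)).
pose c v := (cover_val l (path v) c0)^-1 * cover_val l' (path v) c0.
have c_edge j v w : step (j, false) v = Some w ->
    label l' j (rep v) = (c v)^-1 * label l j (rep v) * c w.
  move=> vw; have hH : path v * gen j * (path w)^-1 \in H.
    apply/stH/(readsM stV (readsM stV (pathP v) _) (readsV stV (pathP w))).
    exact: (@reads_elt _ _ _ (j, false)).
  have := eqH _ hH; rewrite !cover_val_edge // => E.
  rewrite /c invgM invgK -!mulgA; apply: (mulgI (cover_val l' (path v) c0)).
  rewrite mulVKg; apply: (mulIg (cover_val l' (path w) c0)^-1).
  by rewrite -E -!mulgA mulgV mulg1.
pose K := [set x | (x \in p) && (c x.1 == c x.2)].
have cK : congruence step K.
  split=> [v|u v|u v w|a u v u' v']; rewrite !inE /=.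
  - by rewrite pr eqxx.
  - by move=> /andP[/ps -> /eqP ->]; rewrite eqxx.
  - by move=> /andP[uv /eqP ->] /andP[vw /eqP ->]; rewrite (pt _ _ _ uv vw) eqxx.
  move=> /andP[uv /eqP cuv] uu' vv'; rewrite (pc _ _ _ _ _ uv uu' vv') /=.
  have same x y : (x, y) \in p -> rep x = rep y.
    by move=> xy; apply/eqP; rewrite (class_rep_eq _ _ cp).
  case: a uu' vv' => j [] uu' vv'; apply/eqP.
    have := c_edge _ _ _ (stV _ _ _ uu'); have := c_edge _ _ _ (stV _ _ _ vv').
    have -> : rep u' = rep v' by apply/same/(pc _ _ _ _ _ uv uu' vv').
    by rewrite cuv => -> /mulIg /mulIg /invg_inj.
  have := c_edge _ _ _ uu'; have := c_edge _ _ _ vv'.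
  by rewrite (same _ _ uv) cuv => -> /mulgI.
have Kp : {subset p <= K}.
  apply: p_min cK _ => i; rewrite inE Qp /=; apply/eqP.
  have := eq_pair i; rewrite !cover_val_pair /c => E.
  apply: (mulgI (cover_val l (path (Q i).1) c0)); rewrite mulVKg.
  apply: (mulIg (cover_val l' (path (Q i).2) c0)^-1); rewrite -E.
  by rewrite -!mulgA mulgV mulg1.
have cE u v : (u, v) \in p -> c u = c v by move=> /Kp; rewrite inE => /andP[_ /eqP].
(* The base class is settled at [v0], whose path lies in H, the other classes by [eq_path]. *)
have c1 v : c v = 1.
  rewrite (cE _ _ (class_rep_in v cp)) -/rep.
  have [E|ne] := eqVneq (rep v) c0.
    have vv0 : (v, v0) \in p by rewrite -(class_rep_eq _ _ cp); apply/eqP.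
    rewrite (cE _ v0); last exact: pt (ps _ _ (class_rep_in v cp)) vv0.
    by rewrite /c eqH ?mulVg //; apply/stH.
  by rewrite /c eq_path ?mulVg //; exact: (class_repK _ cp).
apply/ffunP => -[[j d] jd]; have /imsetP[v vj /= dE] := jd.
have [w vw] : exists w, step (j, false) v = Some w.
  by move: vj; rewrite inE; case: (step _ v) => // w _; exists w.
have := c_edge _ _ _ vw; rewrite !c1 invg1 mul1g mulg1 /label -dE insubT //= => ->.
Qed.

Definition nonbase : Type := {v : V | (rep v == v) && (v != c0)}.
HB.instance Definition _ := Finite.on nonbase.

Lemma card_nonbase : (1 + #|{: nonbase}| = nclass p)%N.
Proof.
have inR v : (v \in rep @: [set v : V | true]) = (rep v == v).
  apply/imsetP/eqP => [[u _ ->]|<-]; first exact: (class_repK _ cp).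
  by exists v; rewrite // inE.
have repc0 : rep c0 == c0 by apply/eqP; exact: (class_repK _ cp).
rewrite /nclass -/rep (cardsD1 c0) inR repc0 card_sig; congr (1 + _)%N.
by apply: eq_card => v; rewrite !inE inR andbC.
Qed.

Let values (l : {ffun class_edge -> gT}) :
    {ffun 'I_r -> gT} * {ffun 'I_m -> gT} * {ffun nonbase -> gT} :=
  ([ffun i => cover_val l (incl (b i)) c0], [ffun i => cover_val l (pair_elt i) c0],
   [ffun v : nonbase => cover_val l (path (val v)) c0]).

Let values_inj : injective values.
Proof.
move=> l l' [/ffunP E1 /ffunP E2 /ffunP E3]; apply: label_inj => [i|i|v v1 v2].
- by have := E1 i; rewrite !ffunE.
- by have := E2 i; rewrite !ffunE.
have Pv : (rep v == v) && (v != c0) by rewrite v1 eqxx.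
by have := E3 (Sub v Pv); rewrite !ffunE.
Qed.

Let card_values : #|{: {ffun 'I_r -> gT} * {ffun 'I_m -> gT} * {ffun nonbase -> gT}}| =
  (#|gT| ^ (r + m + #|{: nonbase}|))%N.
Proof. by rewrite !card_prod !card_ffun !card_ord !expnD. Qed.

Lemma edges_le : 1 < #|gT| -> 1 + edges step p <= r + m + nclass p.
Proof.
move=> gT1; have := leq_card _ values_inj.
rewrite card_values card_ffun card_class_edge leq_exp2l //.
by have := card_nonbase; lia.
Qed.

(** Equal cardinalities make [values] onto, so some labelling has the prescribed products. [J] is
    the stabiliser of the base class, where the product of labels is multiplicative. *)
Lemma values_onto (f : 'I_r -> gT) (g : 'I_m -> gT) :
  (1 + edges step p = r + m + nclass p)%N ->
  exists (J : groupClosed (free_group k)) (D : free_group k -> gT),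
    [/\ {in J &, {morph D : x y / x * y}},
        forall i, incl (b i) \in J /\ D (incl (b i)) = f i &
        forall i, pair_elt i \in J /\ D (pair_elt i) = g i].
Proof.
move=> E; have [_ stH _] := pres.
have le_card : #|{: {ffun 'I_r -> gT} * {ffun 'I_m -> gT} * {ffun nonbase -> gT}}| <=
    #|{ffun class_edge -> gT}|.
  rewrite card_values card_ffun card_class_edge leq_pexp2l //.
    by apply/card_gt0P; exists 1.
  by have := card_nonbase; lia.
have /codomP[l [/ffunP lf /ffunP lg _]] :=
  inj_card_onto values_inj le_card ([ffun i => f i], [ffun i => g i], [ffun=> 1]).
have [||x|J JE] := @groupClosed_of _ (fun x => cover_end l x c0 = c0).
- exact: cover_end1.
- by move=> x y xE yE; rewrite cover_endM xE.
- exact: cover_endV.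
exists J, (fun x => cover_val l x c0); split=> [x y|i|i].
- by rewrite !JE => /asboolP xE _; rewrite cover_valM xE.
- have := lf i; rewrite !ffunE => ->; split=> //; rewrite JE; apply/asboolP.
  by apply: (@cover_end_reads l v0 _ v0); apply/stH; exact: (valP (b i)).
- have := lg i; rewrite !ffunE => ->; split=> //; rewrite JE; apply/asboolP.
  exact: cover_end_pair.
Qed.

End Cover.

Lemma corank_bound : 1 + edges step p <= r + m + nclass p.
Proof.
have [sigma sigmaE] := class_rep_perms.
(* Any nontrivial finite group gives the bound. *)
apply: (@edges_le sigma {perm bool} sigmaE).
have <- : #|[set 1; tperm true false]| = 2; last exact: max_card.
rewrite cards2; suff -> : 1 != tperm true false by [].
by apply/eqP => /permP /(_ true); rewrite perm1 tpermL.
Qed.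

Lemma corank_ext (gT : finGroupType) (f : 'I_r -> gT) (g : 'I_m -> gT) :
  (1 + edges step p = r + m + nclass p)%N ->
  exists (J : groupClosed (free_group k)) (D : free_group k -> gT),
    [/\ {in J &, {morph D : x y / x * y}},
        forall i, incl (b i) \in J /\ D (incl (b i)) = f i &
        forall i, pair_elt i \in J /\ D (pair_elt i) = g i].
Proof.
by have [sigma sigmaE] := class_rep_perms; apply: (@values_onto sigma gT sigmaE).
Qed.

End Labels.

(** * Complements of a free factor of corank one *)

Section Words.
Variable k : nat.
Implicit Types (s v : seq (letter k)) (a : letter k).

Lemma reduced_nth a0 s i : reduced s -> i.+1 < size s -> nth a0 s i.+1 != linv (nth a0 s i).
Proof.
elim: s i => [|a [|b s] IH] [|i] //= /andP[ab rs]; first by [].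
exact: IH.
Qed.

Lemma reduced_cat s v : reduced (s ++ v) -> reduced s /\ reduced v.
Proof.
elim: s => //= a s IH; case: s IH => [|b s] IH /=; first by case/andP.
by move=> /= /andP[-> /IH].
Qed.

Lemma sval_prod_elt s : reduced s -> sval (\prod_(a <- s) elt a) = s.
Proof.
move=> rs; rewrite -[RHS](foldr_push_id rs); elim: s {rs} => [|a s IH].
  by rewrite big_nil.
by rewrite big_cons elt_mul IH.
Qed.

Lemma linv_neq a : a != linv a.
Proof. by case: a => i []; apply/eqP => -[]. Qed.

Section Cycle.
Variables (a0 : letter k) (v : seq (letter k)).
Let n := size v.
Hypotheses (rv : reduced v) (v0 : 0 < n).
Hypothesis cyclic_v : head a0 v != linv (last a0 v).

(** Vertex [i] is left forwards by the letter at [i], backwards by the inverse of the previous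
    letter; these differ since [v] is cyclically reduced. *)
Definition cycle_step a (i : 'I_n) : option 'I_n :=
  if a == nth a0 v i then Some (ordS i)
  else if a == linv (nth a0 v (ord_pred i)) then Some (ord_pred i) else None.

Lemma nth_ordS (i : 'I_n) : nth a0 v (ordS i) != linv (nth a0 v i).
Proof.
rewrite -[nat_of_ord (ordS i)]/(i.+1 %% n).
have [lt_in|] := ltnP i.+1 n; first by rewrite modn_small // reduced_nth.
move=> le_ni; have -> : i.+1 = n by apply/eqP; rewrite eqn_leq le_ni ltn_ord.
rewrite modnn nth0; suff -> : nth a0 v i = last a0 v by [].
by rewrite -nth_last; congr nth; move: le_ni (ltn_ord i); rewrite -/n; lia.
Qed.

Lemma cycle_stepV : step_inv cycle_step.
Proof.
move=> a i j; rewrite /cycle_step; case: eqVneq => [-> [<-]|_].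
  by rewrite eq_sym (negPf (nth_ordS i)) ordSK eqxx.
case: eqVneq => [-> [<-]|//].
by rewrite linvK eqxx ord_predK.
Qed.

Lemma run_cycle : run cycle_step (Ordinal v0) v = Some (Ordinal v0).
Proof.
suff H d (i : 'I_n) : (i + d)%N = n -> run cycle_step i (drop i v) = Some (Ordinal v0).
  by have := H n (Ordinal v0) erefl; rewrite drop0.
elim: d i => [|d IH] i E; first by move: (ltn_ord i) E; lia.
rewrite (drop_nth a0) //=.
have -> : cycle_step (nth a0 v i) i = Some (ordS i) by rewrite /cycle_step eqxx.
rewrite /=.
have vE : val (ordS i) = i.+1 %% n by [].
case: d IH E => [|d] IH E.
  have iE : i.+1 = n by move: E; lia.
  by rewrite iE drop_size /=; congr Some; apply/val_inj; rewrite vE iE modnn.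
have lt_in : i.+1 < n by move: E; lia.
have vE' : val (ordS i) = i.+1 by rewrite vE modn_small.
have := IH (ordS i); rewrite [nat_of_ord (ordS i)]vE' => -> //.
by move: E; lia.
Qed.

End Cycle.

(* The graph is the Stallings graph of the cyclic subgroup generated by a :: s:
   a cycle, joined to the base point by a path if the word is not cyclically
   reduced. *)
Lemma lollipop a s : reduced (a :: s) ->
  exists (T : eqType) (step : letter k -> T -> option T) (o : T),
    [/\ step_inv step, run step o (a :: s) = Some o,
        forall c z, step c o = Some z -> c = a \/ c = linv (last a s) &
        s != [::] -> forall c, step c o != Some o].
Proof.
have [n] := ubnP (size s); elim: n a s => // n IH a s; rewrite ltnS => sn rs.
have [E|cyc] := eqVneq a (linv (last a s)); last first.
  pose o : 'I_(size (a :: s)) := Ordinal (ltn0Sn (size s)).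
  exists 'I_(size (a :: s)), (@cycle_step a (a :: s)), o; split.
  - exact: cycle_stepV.
  - exact: run_cycle.
  - move=> c z; rewrite /cycle_step; case: eqVneq => [-> _|_]; first by left.
    case: eqVneq => // -> _; right; congr linv.
    have -> : nat_of_ord (ord_pred o) = size s.
      by rewrite /= modn_small //; lia.
    by rewrite (last_nth a).
  - move=> s0 c; rewrite /cycle_step; case: ifP => _.
      apply/eqP => -[] /=; rewrite modn_small //.
      by case: (s) s0.
    case: ifP => // _; apply/eqP => -[] /=; rewrite modn_small; last by lia.
    by case: (s) s0.
case/lastP: s E sn rs => [|s d]; first by move=> /eqP; rewrite (negPf (linv_neq a)).
rewrite last_rcons => E; case: s => [|b s] sn rs.
  by move: rs; rewrite /= E linvK eqxx.
have [_ rbsd] := @reduced_cat [:: a] (rcons (b :: s) d) rs.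
have [rbs _] : reduced (b :: s) /\ reduced [:: d].
  by apply: reduced_cat; rewrite cats1.
have [|T [step [o [stV ro ho _]]]] := IH b s _ rbs.
  by move: sn; rewrite size_rcons; apply: leq_trans.
(* The new base point is joined to [o] by an edge labelled [a], so the inverse of [a] must be free
   at [o]; otherwise letters of the word would cancel. *)
have na : step (linv a) o = None.
  case Eo: (step _ o) => [z|] //; case: (ho _ _ Eo) => [Eb|].
    by move: rs; rewrite /= -Eb eqxx.
  by move=> /(can_inj (@linvK k)) Ea; move: rbsd; rewrite reduced_rcons /= -Ea E eqxx.
pose step' c (z : option T) := if z is Some z' then
    if (z' == o) && (c == linv a) then Some None else omap Some (step c z')
  else if c == a then Some (Some o) else None.
exists (option T : eqType), step', None; split.
- move=> c [z|] w /=; last by case: eqVneq => // -> [<-] /=; rewrite !eqxx.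
  case: ifP => [/andP[/eqP -> /eqP ->] [<-]|_] /=; first by rewrite linvK eqxx.
  case Ez: (step c z) => [z'|] //= [<-] /=; rewrite (stV _ _ _ Ez) /=.
  by case: ifP => // /andP[/eqP Eo /eqP Ec]; move: (stV _ _ _ Ez); rewrite Ec Eo na.
- have sub u z w : run step z u = Some w -> run step' (Some z) u = Some (Some w).
    elim: u z => [|c u IHu] z /=; first by case=> ->.
    case Ez: (step c z) => [z'|] //= /IHu R; case: ifP => [/andP[/eqP Eo /eqP Ec]|_ //].
    by move: Ez; rewrite Eo Ec na.
  have -> : run step' None (a :: rcons (b :: s) d) = run step' (Some o) (rcons (b :: s) d).
    by rewrite /= eqxx.
  by rewrite run_rcons (sub _ _ _ ro) /= eqxx E linvK eqxx.
- by move=> c z /=; case: eqVneq => // -> _; left.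
- by move=> _ c /=; case: ifP.
Qed.

Lemma split_first (P : pred (letter k)) s : has P s ->
  exists s1 a s2, [/\ s = s1 ++ a :: s2, P a & all (predC P) s1].
Proof.
elim: s => //= a s IH; have [Pa _|nPa /= /IH[s1 [c [s2 [-> Pc As1]]]]] := boolP (P a).
  by exists [::], a, s.
by exists (a :: s1), c, s2; rewrite /= nPa.
Qed.

Lemma split_last (P : pred (letter k)) s : has P s ->
  exists s1 a s2, [/\ s = rcons s1 a ++ s2, P a & all (predC P) s2].
Proof.
rewrite -has_rev => /split_first[s1 [a [s2 [E Pa As1]]]].
exists (rev s2), a, (rev s1); split=> //; last by rewrite all_rev.
by rewrite -[LHS]revK E rev_cat rev_cons.
Qed.

Variable y : 'I_k.

Definition avoids (x : free_group k) : bool := all (fun a => a.1 != y) (sval x).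

(* If t starts and ends with the letter y, then the Stallings graph of the
   subgroup generated by t and the other generators is the one of t with loops
   added at the base point, so y belongs to it only if t has length one. *)
Lemma complement_elt (t : free_group k) :
  (forall S : groupClosed (free_group k),
     (forall i, i != y -> gen i \in S) -> t \in S -> gen y \in S) ->
  exists x1 e x2, [/\ avoids x1, avoids x2 & t = x1 * elt (y, e) * x2].
Proof.
move=> gen_y.
(* The elements read as loops at [o] form a subgroup; it contains [t] and the generators other than
   [y], hence [gen y]. *)
have loops (T : eqType) (step : letter k -> T -> option T) (o : T) :
    step_inv step -> (forall c, c.1 != y -> step c o = Some o) ->
    reads step o t o -> step (y, false) o = Some o.
  move=> stV so to.
  have [||x|S SE] := @groupClosed_of _ (fun x => reads step o x o).
  - by [].
  - by move=> x z xo zo; exact: (readsM stV xo zo).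
  - exact: readsV.
  have : gen y \in S.
    apply: gen_y => [i iy|]; rewrite SE; apply/asboolP => //.
    by apply: (@reads_elt _ _ _ (i, false)); exact: so.
  by rewrite SE => /asboolP; rewrite /reads /=; case: (step _ o).
have loop_avoid (T : eqType) (step : letter k -> T -> option T) (o : T) s :
    (forall c, c.1 != y -> step c o = Some o) -> all (fun a => a.1 != y) s ->
    run step o s = Some o.
  by move=> so; elim: s => //= a s IH /andP[/so -> /IH].
(* If [y] does not occur in [t], one vertex with loops for all other letters reads [t] but not
   [y]. *)
have [|nt] := boolP (has (fun a => a.1 == y) (sval t)); last first.
  pose step (a : letter k) (_ : unit) := if a.1 == y then None else Some tt.
  have so c : c.1 != y -> step c tt = Some tt by rewrite /step => /negPf ->.
  have stV : step_inv step by move=> a [] [] /=; rewrite /step /=; case: eqP.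
  suff : step (y, false) tt = Some tt by rewrite /step eqxx.
  by apply: (loops _ _ _ stV so); apply: (loop_avoid _ _ _ _ so); rewrite -all_predC in nt.
move=> /split_first[s1 [a [s' [tE ay s1y]]]].
have /split_last[m [d [s2 [mE dy s2y]]]] : has (fun a => a.1 == y) (a :: s') by rewrite /= ay.
rewrite mE in tE; have rt : reduced (s1 ++ rcons m d ++ s2) by rewrite -tE (svalP t).
have [rs1 /reduced_cat[rm rs2]] := reduced_cat rt.
have Et : t = \prod_(c <- s1) elt c * \prod_(c <- rcons m d) elt c * \prod_(c <- s2) elt c.
  by rewrite -[LHS]prod_elt tE !big_cat /= mulgA.
case: m mE rm {tE rt} Et => [|a' m] mE rm Et.
  exists (\prod_(c <- s1) elt c), d.2, (\prod_(c <- s2) elt c).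
  rewrite /avoids !sval_prod_elt // s1y s2y; split=> //.
  by rewrite Et big_seq1 -(eqP dy) -surjective_pairing.
(* The part from the first to the last [y] now has several letters. Its graph has no loop at [o],
   and only edges labelled [y] leave [o], so loops for the other letters can be added there. *)
exfalso; case: mE => aa' _; subst a'.
have [T [step [o [stV ro ho no]]]] := lollipop rm.
have oy c z : step c o = Some z -> c.1 == y.
  by move=> /ho []->; rewrite //= last_rcons.
pose step' c z := if (z == o) && (c.1 != y) then Some o else step c z.
have sub c z w : step c z = Some w -> step' c z = Some w.
  rewrite /step'; case: eqVneq => [->|//] E; by rewrite (oy _ _ E).
have runs u z w : run step z u = Some w -> run step' z u = Some w.
  elim: u z => [|c u IHu] z //=.
  by case E: (step c z) => [z'|] //=; rewrite (sub _ _ _ E); exact: IHu.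
have so c : c.1 != y -> step' c o = Some o by rewrite /step' eqxx => ->.
have stV' : step_inv step'.
  move=> c z w; rewrite {1}/step'; case: ifP => [/andP[/eqP -> cy] [<-]|_ /stV /sub //].
  exact: so.
have : step' (y, false) o = Some o.
  apply: (loops _ _ _ stV' so); rewrite Et.
  have rs s : all (fun a => a.1 != y) s -> reads step' o (\prod_(c <- s) elt c) o.
    by move=> sy; apply: (reads_prod stV'); exact: (loop_avoid _ _ _ _ so).
  apply: (readsM stV' (readsM stV' (rs _ s1y) _) (rs _ s2y)).
  exact: (reads_prod stV' (runs _ _ _ ro)).
by rewrite /step' eqxx eqxx /=; apply/eqP; apply: no; case: (m).
Qed.
End Words.

(** * Quotients generated by a pair of vertices *)

Section Pairs.
Variables (k r : nat) (H : groupClosed (free_group k)).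
Variable b : 'I_r -> subgroup H.
Hypothesis b_basis : basis (range b).
Hypothesis b_inj : injective b.
Variables (V : finType) (step : letter k -> V -> option V) (v0 : V).
Hypothesis pres : presents step v0 H.
Variable path : V -> free_group k.
Hypothesis pathP : forall v, reads step v0 (path v) v.

Lemma mem_of_gens (S : groupClosed (free_group k)) :
  (forall i, incl (b i) \in S) -> forall x, x \in H -> x \in S.
Proof.
move=> bS x xH; rewrite -[x]/(incl (exist (fun z => z \in H) x xH : subgroup H)).
move: (exist _ x xH : subgroup H).
apply: (generates_ind (P := fun h => incl h \in S) (basis_generates b_basis)).
- exact: gpred1.
- by move=> y z yS zS; rewrite incl_is_multiplicative gpredM.
- by move=> y yS; rewrite (morph_inv (@incl_is_multiplicative _ H)) gpredV.
- by move=> _ [i _ <-]; exact: bS.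
Qed.

Definition pair_cong (u v : V) : {set V * V} :=
  [set x | `[< forall q, congruence step q -> (u, v) \in q -> x \in q >]].

Lemma mem_pair_cong u v : (u, v) \in pair_cong u v.
Proof. by rewrite inE; apply/asboolP. Qed.

Lemma pair_cong_min u v q : congruence step q -> (u, v) \in q -> {subset pair_cong u v <= q}.
Proof. by move=> cq uv x; rewrite inE => /asboolP; apply. Qed.

Lemma congruence_pair_cong u v : congruence step (pair_cong u v).
Proof.
split=> [x|x y|x y z|a x y x' y']; rewrite !inE.
- by apply/asboolP => q [qr].
- by move=> /asboolP xy; apply/asboolP => q cq uv; have [_ qs _ _] := cq; apply/qs/xy.
- move=> /asboolP xy /asboolP yz; apply/asboolP => q cq uv; have [_ _ qt _] := cq.
  exact: qt (xy _ cq uv) (yz _ cq uv).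
- move=> /asboolP xy xx' yy'; apply/asboolP => q cq uv; have [_ _ _ qc] := cq.
  exact: qc (xy _ cq uv) xx' yy'.
Qed.

Definition pair_word (u v : V) : free_group k := path u * (path v)^-1.

(* Leading to the same coset of S is a congruence on the vertices. *)
Lemma pair_word_mem (S : groupClosed (free_group k)) u v x y :
  (forall z, z \in H -> z \in S) -> pair_word u v \in S ->
  (x, y) \in pair_cong u v -> pair_word x y \in S.
Proof.
have [stV stH _] := pres; move=> HS uvS.
pose q := [set x | pair_word x.1 x.2 \in S].
suff cq : congruence step q by move=> /(pair_cong_min cq); rewrite !inE; apply.
split=> [z|z w|z w t|a z w z' w']; rewrite !inE /=; rewrite /pair_word.
- by rewrite mulgV gpred1.
- by rewrite -gpredV invgM invgK.
- by move=> zw wt; have := gpredM _ _ zw wt; rewrite mulgA mulgVK.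
move=> zw zz' ww'.
have edge t t' : step a t = Some t' -> path t * elt a * (path t')^-1 \in S.
  move=> tt'; apply/HS/stH/(readsM stV (readsM stV (pathP t) _) (readsV stV (pathP t'))).
  exact: reads_elt.
have := edge _ _ zz'; rewrite -gpredV !invgM !invgK => ez.
have := gpredM _ _ (gpredM _ _ ez zw) (edge _ _ ww').
by rewrite !mulgA mulgVK mulgVK mulgVK.
Qed.

Definition add_gen (x : free_group k) (i : 'I_r.+1) : free_group k :=
  if unlift ord_max i is Some j then incl (b j) else x.

Lemma add_gen_max x : add_gen x ord_max = x.
Proof. by rewrite /add_gen unlift_none. Qed.

Lemma add_gen_lift x j : add_gen x (lift ord_max j) = incl (b j).
Proof. by rewrite /add_gen liftK. Qed.

Section Same.
Variables (u v : V).
Hypothesis rank_uv : (edges step (pair_cong u v) = r + nclass (pair_cong u v))%N.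

(** By [corank_ext] for one generating pair, the values on the basis of H and on the pair word can
    be prescribed in any finite group, so these r + 1 elements are free. *)
Lemma pair_hom_inj : injective (free_hom (add_gen (pair_word u v))).
Proof.
apply: free_hom_inj => gT f.
have Q1 (i : 'I_1) : (u, v) \in pair_cong u v := mem_pair_cong u v.
have Qm q : congruence step q -> (forall i : 'I_1, (u, v) \in q) -> {subset pair_cong u v <= q}.
  by move=> cq /(_ ord0); exact: pair_cong_min.
have [|J [D [DM Db Du]]] := corank_ext b_basis pres (congruence_pair_cong u v) pathP Q1 Qm
  (fun i => f (lift ord_max i)) (fun=> f ord_max).
  by rewrite rank_uv addnAC addnC.
exists J, D; split=> // i; rewrite /add_gen.
by case: unliftP => [j ->|->]; [exact: Db|exact: (Du ord0)].
Qed.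

Variables (u' v' : V).
Hypothesis same : pair_cong u' v' = pair_cong u v.

(** Both pair words generate the same group together with H. Pulled back along the injective [phi],
    the second one is an element [t] which, with the first r generators, generates the last one, so
    [complement_elt] applies. *)
Lemma pair_word_same : exists h1 h2, [/\ h1 \in H, h2 \in H &
  pair_word u' v' = h1 * pair_word u v * h2 \/ pair_word u' v' = h1 * pair_word v u * h2].
Proof.
set phi := free_hom (add_gen (pair_word u v)).
have phiM : {morph phi : x y / x * y} by exact: free_hom_is_multiplicative.
have phi_lift j : phi (gen (lift ord_max j)) = incl (b j) by rewrite /phi free_hom_gen add_gen_lift.
have phi_max : phi (gen ord_max) = pair_word u v by rewrite /phi free_hom_gen add_gen_max.
have image (S : groupClosed (free_group r.+1)) : exists S' : groupClosed (free_group k),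
    forall x, x \in S' <-> exists2 t, t \in S & phi t = x.
  have [|x y|x|S' SE] := @groupClosed_of _ (fun x => exists2 t, t \in S & phi t = x).
  - by exists 1; rewrite ?gpred1 // (morph_one phiM).
  - by move=> [t tS <-] [w wS <-]; exists (t * w); rewrite ?gpredM ?phiM.
  - by move=> [t tS <-]; exists t^-1; rewrite ?gpredV ?(morph_inv phiM).
  by exists S' => x; rewrite SE; split=> /asboolP.
have [t tE] : exists t, phi t = pair_word u' v'.
  have [T TE] := @groupClosed_of (free_group r.+1) (fun=> True) I
    (fun _ _ _ _ => I) (fun _ _ => I).
  have [S SE] := image T.
  have inT x : x \in T by rewrite TE; apply/asboolP.
  suff /SE[t _ tE] : pair_word u' v' \in S by exists t.
  apply: (@pair_word_mem S u v); last by rewrite -same mem_pair_cong.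
    by apply: mem_of_gens => i; apply/SE; exists (gen (lift ord_max i)).
  by apply/SE; exists (gen ord_max).
have [|x1 [e [x2 [x1y x2y tx]]]] := @complement_elt r.+1 ord_max t.
  move=> S gS tS; have [S' SE] := image S.
  suff /SE[s sS] : pair_word u v \in S' by rewrite -phi_max => /pair_hom_inj <-.
  apply: (@pair_word_mem S' u' v'); last by rewrite same mem_pair_cong.
    apply: mem_of_gens => i; apply/SE; exists (gen (lift ord_max i)) => //.
    by apply: gS; rewrite eq_sym neq_lift.
  by apply/SE; exists t.
have phiH x : avoids ord_max x -> phi x \in H.
  rewrite /avoids -{2}(prod_elt x); elim: (sval x) => [_|[j c] s IH] /=.
    by rewrite big_nil (morph_one phiM) gpred1.
  case/andP => jy /IH sH; rewrite big_cons phiM gpredM //.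
  have [i ->] : exists i, j = lift ord_max i.
    by case: (unliftP ord_max j) jy => [i ->|->]; rewrite ?eqxx //; exists i.
  rewrite /phi free_hom_elt /eval_letter -/phi /= add_gen_lift.
  by case: c => //=; rewrite ?gpredV; exact: (valP (b i)).
exists (phi x1), (phi x2); rewrite !phiH //; split=> //.
rewrite -tE tx !phiM [phi (elt _)]free_hom_elt /eval_letter /= add_gen_max.
by case: (e); [right; rewrite /pair_word invgM invgK|left].
Qed.

(** If the new pair word is [h1 * pair_word x y * h2], then (path x)^-1 h1^-1 path u' = (path y)^-1
    h2 path v', and this one element moves both vertices of the pair. *)
Lemma pair_path_same : 
  (exists z, reads step u z u' /\ reads step v z v') \/
  (exists z, reads step v z u' /\ reads step u z v').
Proof.
have [stV stH _] := pres.
have [h1 [h2 [h1H h2H E]]] := pair_word_same.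
have aux x y : pair_word u' v' = h1 * pair_word x y * h2 ->
    exists z, reads step x z u' /\ reads step y z v'.
  move=> Exy; exists ((path x)^-1 * h1^-1 * path u'); split.
    apply: (readsM stV (readsM stV (readsV stV (pathP x)) _) (pathP u')).
    by apply: readsV => //; apply/stH.
  have -> : (path x)^-1 * h1^-1 * path u' = (path y)^-1 * h2 * path v'.
    apply: (mulIg (path v')^-1); rewrite -[LHS]mulgA -/(pair_word u' v') Exy /pair_word.
    by rewrite !mulgA mulgK mulgVK mulVg mul1g.
  apply: (readsM stV (readsM stV (readsV stV (pathP y)) _) (pathP v')).
  exact/stH.
by case: E => /aux; [left|right].
Qed.
End Same.

(** Functions constant on the components of the graph of ordered pairs of distinct vertices. *)
Definition pair_invariant (h : V -> V -> bool) :=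
  forall j u v u' v', u != v -> step (j, false) u = Some u' -> step (j, false) v = Some v' ->
    h u v = h u' v'.

Lemma pair_invariant_reads h u v z u' v' : pair_invariant h -> u != v ->
  reads step u z u' -> reads step v z v' -> h u v = h u' v'.
Proof.
have [stV _ _] := pres; move=> hi; rewrite /reads.
elim: (sval z) u v => [|a s IH] u v uv /=; first by case=> <- [<-].
case Eu: (step a u) => [x|] //=; case Ev: (step a v) => [y|] //= xu' yv'.
have xy : x != y.
  by apply: contraNN uv => /eqP xy; have := stV _ _ _ Eu; rewrite xy (stV _ _ _ Ev) => -[->].
rewrite -(IH _ _ xy xu' yv'); case: a Eu Ev => j [] Eu Ev; last exact: hi uv Eu Ev.
exact/esym/(hi j _ _ _ _ xy (stV _ _ _ Eu) (stV _ _ _ Ev)).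
Qed.

Lemma pair_cong_connected h u v u' v' : pair_invariant h -> u != v ->
  (edges step (pair_cong u v) = r + nclass (pair_cong u v))%N ->
  pair_cong u' v' = pair_cong u v -> h u' v' = h u v \/ h u' v' = h v u.
Proof.
move=> hi uv rank_uv /(pair_path_same rank_uv)[] [z [Ru Rv]].
  by left; rewrite (pair_invariant_reads hi uv Ru Rv).
by right; rewrite (pair_invariant_reads hi _ Ru Rv) // eq_sym.
Qed.

End Pairs.

Lemma bin2_square n : (2 * 'C(n, 2) + n = n * n)%N.
Proof. by elim: n => // n; rewrite binS bin1; lia. Qed.

Lemma card_offdiag (V : finType) (D : {set V}) :
  (#|[set x : V * V | [&& x.1 \in D, x.2 \in D & x.1 != x.2]]| = 2 * 'C(#|D|, 2))%N.
Proof.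
apply/eqP; rewrite -(eqn_add2r #|D|) bin2_square -cardsX; apply/eqP.
have <- : #|[set (v, v) | v in D]| = #|D| by apply: card_imset => u v [].
rewrite -[RHS](cardsID [set (v, v) | v in D]) addnC; congr (_ + _)%N; apply: eq_card => -[u v].
  rewrite !inE /=; apply/imsetP/andP => [[w wD [-> ->]]|[/andP[uD _] /imsetP[w wD E]]].
    by rewrite wD imset_f.
  by exists w.
have -> : ((u, v) \in finset.setX D D :\: [set (v, v) | v in D]) =
  ((u, v) \notin [set (v, v) | v in D]) && ((u \in D) && (v \in D)) by rewrite !inE.
rewrite !inE /=; have [->|uv] := eqVneq u v.
  by rewrite !andbF; case vD: (v \in D); rewrite ?andbF // imset_f.
rewrite andbT; suff -> : (u, v) \notin [set (v, v) | v in D] by [].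
by apply/imsetP => -[w _ [E1 E2]]; rewrite E1 E2 eqxx in uv.
Qed.

(** * Quotients of corank one and generators extending a basis of H *)

Section Main.
Variables (k r : nat) (H : groupClosed (free_group k)).
Variable b : 'I_r -> subgroup H.
Hypothesis b_basis : basis (range b).
Hypothesis b_inj : injective b.
Hypothesis mpH : measure_preserving H.
Variables (V : finType) (step : letter k -> V -> option V) (v0 : V).
Hypothesis pres : presents step v0 H.
Variable path : V -> free_group k.
Hypothesis pathP : forall v, reads step v0 (path v) v.

Let cong p := `[< congruence step p >].

(** The trivial congruence is generated by the empty family of pairs, so [corank_bound] applies with
    m = 0. *)
Lemma diag_rank : 1 + edges step (diag V) <= r + nclass (diag V).
Proof.
have min q : congruence step q -> (forall i : 'I_0, (v0, v0) \in q) -> {subset diag V <= q}.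
  by case=> qr _ _ _ _ [u v]; rewrite inE /= => /eqP ->.
have Q0 (i : 'I_0) : (v0, v0) \in diag V by rewrite inE.
have := corank_bound b_basis pres (congruence_diag step) pathP Q0 min.
by rewrite addn0.
Qed.

(** Being nontrivial, the congruence has corank at least one; being generated by one pair, at most
    one. *)
Lemma pair_cong_rank u v : u != v ->
  edges step (pair_cong step u v) = (r + nclass (pair_cong step u v))%N.
Proof.
move=> uv; apply/eqP; rewrite eqn_leq.
have cuv := congruence_pair_cong step u v.
rewrite (nondiag_rank b_basis b_inj pres mpH diag_rank cuv) ?andbT; last first.
  apply: contraNneq uv => E; have := mem_pair_cong step u v.
  by rewrite E inE.
have Q1 (i : 'I_1) : (u, v) \in pair_cong step u v := mem_pair_cong step u v.
have Qm q : congruence step q -> (forall i : 'I_1, (u, v) \in q) -> {subset pair_cong step u v <= q}.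
  by move=> cq /(_ ord0); exact: pair_cong_min.
have := corank_bound b_basis pres cuv pathP Q1 Qm.
by lia.
Qed.

Definition corank_one : {set {set V * V}} :=
  [set p : {set V * V} | cong p & r + nclass p == edges step p].

Lemma pair_cong_corank_one u v : u != v -> pair_cong step u v \in corank_one.
Proof.
by move=> uv; rewrite inE (pair_cong_rank uv) eqxx andbT; apply/asboolP/congruence_pair_cong.
Qed.

Definition edge_pair : Type :=
  {x : 'I_k * (V * V) |
     [&& x.2.1 \in source step x.1, x.2.2 \in source step x.1 & x.2.1 != x.2.2]}.
HB.instance Definition _ := Finite.on edge_pair.

Lemma card_edge_pair : (#|{: edge_pair}| = \sum_j (2 * 'C(#|source step j|, 2)))%N.
Proof.
rewrite card_sig -sum1_card (eq_bigl (fun x : 'I_k * (V * V) => true &&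
  [&& x.2.1 \in source step x.1, x.2.2 \in source step x.1 & x.2.1 != x.2.2])) //.
rewrite -(pair_big_dep xpredT (fun j (v : V * V) =>
  [&& v.1 \in source step j, v.2 \in source step j & v.1 != v.2]) (fun _ _ => 1%N)) /=.
apply: eq_bigr => j _; rewrite -card_offdiag sum1dep_card.
by apply: eq_card => x; rewrite !inE.
Qed.

(* A boolean function on pairs is determined by its increments along the edges
   of the graph of pairs, its values on the diagonal, and its values at the two
   orientations of one generating pair for each congruence; if p were not
   generated by a pair, this would contradict card_corank_one. *)
Lemma corank_one_pair p : p \in corank_one -> exists u v, u != v /\ pair_cong step u v = p.
Proof.
move=> pS; apply: contrapT => no_pair.
(* Leaving out [p], which no pair generates, saves two bits in the count. *)
pose S' := corank_one :\ p; pose St : finType := {q : {set V * V} | q \in S'}.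
pose nxt j u := odflt u (step (j, false) u).
pose pt (q : {set V * V}) : V * V :=
  odflt (v0, v0) [pick x : V * V | (x.1 != x.2) && (pair_cong step x.1 x.2 == q)].
pose T (g : {ffun V * V -> bool}) :
    {ffun edge_pair -> bool} * {ffun V -> bool} * ({ffun St -> bool} * {ffun St -> bool}) :=
  ([ffun e : edge_pair =>
      g (val e).2 (+) g (nxt (val e).1 (val e).2.1, nxt (val e).1 (val e).2.2)],
   [ffun v => g (v, v)],
   ([ffun q : St => g (pt (val q))], [ffun q : St => g ((pt (val q)).2, (pt (val q)).1)])).
have T_inj : injective T.
  move=> g g' [/ffunP E1 /ffunP E2 /ffunP E3 /ffunP E4].
  pose h u v := g (u, v) (+) g' (u, v).
  have hi : pair_invariant step h.
    move=> j u v u' v' uv uu' vv'.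
    have Pe : [&& u \in source step j, v \in source step j & u != v] by rewrite !inE uu' vv' uv.
    have := E1 (Sub (j, (u, v)) Pe); rewrite !ffunE /= /nxt uu' vv' /= /h.
    by case: (g _); case: (g _); case: (g' _); case: (g' _).
  apply/ffunP => -[u v]; suff : ~~ h u v by rewrite /h; case: (g _); case: (g' _).
  have [->|uv] := eqVneq u v; first by have := E2 v; rewrite !ffunE /h => ->; rewrite addbb.
  have qS : pair_cong step u v \in S'.
    by rewrite in_setD1 pair_cong_corank_one // andbT; apply/eqP => E; apply: no_pair; exists u, v.
  have := E3 (exist (fun q => q \in S') _ qS); have := E4 (exist (fun q => q \in S') _ qS).
  rewrite !ffunE /= /pt.
  case: pickP => [[x y] /= /andP[xy /eqP Exy]|/(_ (u, v))]; last by rewrite /= uv eqxx.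
  move=> gyx gxy.
  have [] := pair_cong_connected b_basis pres pathP hi xy (pair_cong_rank xy) (esym Exy) => ->.
    by rewrite /h gxy addbb.
  by rewrite /h gyx addbb.
(* With n = |V|, s = |corank_one| and E the sum of the binomials over the labels, injectivity gives
   n^2 <= 2 E + n + 2 (s - 1), but [card_corank_one] gives n^2 = 2 E + n + 2 s. *)
have := leq_card _ T_inj.
rewrite !card_prod !card_ffun card_bool card_prod card_edge_pair.
have -> : #|{: St}| = #|corank_one|.-1 by rewrite card_sig (cardsD1 p corank_one) pS.
rewrite -!expnD leq_exp2l // -big_distrr /=.
have := card_corank_one b_basis b_inj pres mpH diag_rank; rewrite -/corank_one.
have : 0 < #|corank_one| by apply/card_gt0P; exists p.
rewrite -bin2_square; set X := (\sum_j 'C(_, _))%N.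
move: #|corank_one| #|V| X => s n X. lia.
Qed.

Lemma complement_gens (x : free_group k) : k = r.+1 ->
  (forall S : groupClosed (free_group k), (forall h, h \in H -> h \in S) -> x \in S ->
     forall y, y \in S) ->
  exists c : 'I_k -> free_group k,
    generates (range c) /\ forall i, exists j, c j = incl (b i).
Proof.
move=> kr gx; exists (fun i => add_gen b x (cast_ord kr i)); split=> [S cS|i].
  apply: gx => [h|].
    apply: (mem_of_gens b_basis) => i; rewrite -(add_gen_lift b x i); apply: cS.
    by exists (cast_ord (esym kr) (lift ord_max i)); rewrite ?cast_ordKV.
  rewrite -[x](add_gen_max b); apply: cS.
  by exists (cast_ord (esym kr) ord_max); rewrite ?cast_ordKV.
by exists (cast_ord (esym kr) (lift ord_max i)); rewrite cast_ordKV add_gen_lift.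
Qed.

(** The quotient by the full congruence is a bouquet with one loop for each generator that labels an
    edge; its rank is compared with r and k. *)
Lemma extends_to_generators : k - 1 <= r ->
  exists c : 'I_k -> free_group k,
    generates (range c) /\ forall i, exists j, c j = incl (b i).
Proof.
have [stV stH stC] := pres.
move=> kr; pose full : {set V * V} := [set _ | true].
have cfull : congruence step full by split=> *; rewrite inE.
have rep_full v : class_rep full v = class_rep full v0.
  by apply/eqP; rewrite (class_rep_eq _ _ cfull) inE.
have card_full (A : {set V}) : #|class_rep full @: A| = (A != finset.set0).
  have [->|[v vA]] := set_0Vmem A; first by rewrite imset0 cards0 eqxx.
  have -> : class_rep full @: A = [set class_rep full v0].
    apply/setP => w; rewrite inE; apply/imsetP/eqP => [[u _ ->] //|->].
    by exists v.
  by rewrite cards1; case: eqP vA => // ->; rewrite inE.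
have nfull : nclass full = 1%N.
  by rewrite /nclass card_full; case: eqP => // /setP/(_ v0); rewrite !inE.
pose used := [set j | source step j != finset.set0].
have efull : edges step full = #|used|.
  rewrite /edges -sum1_card [RHS]big_mkcond; apply: eq_bigr => j _.
  by rewrite /nedge card_full inE; case: (_ != _).
have used_k : #|used| <= k by rewrite -[k in _ <= k]card_ord max_card.
have usedP j : j \in used -> exists v w, step (j, false) v = Some w.
  rewrite inE => /set0Pn[v]; rewrite inE; case E: (step _ v) => [w|] // _.
  by exists v, w.
have all_used : #|used| = k -> forall j, j \in used.
  move=> E j; apply: contraT => ju; suff : #|used| < k by rewrite E ltnn.
  rewrite -[X in _ < X]card_ord -cardsT proper_card // properE finset.subsetT /=.
  by apply/fintype.subsetPn; exists j.
have gens_mem (S : groupClosed (free_group k)) j : (forall h, h \in H -> h \in S) ->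
    (forall v, path v \in S) -> j \in used -> gen j \in S.
  move=> HS pS /usedP[v [w vw]].
  have : path v * gen j * (path w)^-1 \in S.
    apply/HS/stH/(readsM stV (readsM stV (pathP v) _) (readsV stV (pathP w))).
    exact: (@reads_elt _ _ _ (j, false)).
  by rewrite gpredMr ?gpredV // gpredMl.
have path0 : path v0 \in H by apply/stH.
have r_full := congruence_rank b_basis b_inj pres mpH cfull.
rewrite nfull efull in r_full.
have r_diag := diag_rank.
(* If the graph has one vertex, H contains the generators in [used], which number r, and at most one
   generator is missing. *)
have [fd|nfd] := eqVneq full (diag V).
  have Vsub v : v = v0.
    have : (v, v0) \in full by rewrite inE.
    by rewrite fd inE => /eqP.
  have rE : r = #|used|.
    by move: r_diag; rewrite -fd nfull efull; move: r_full; lia.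
  have genH j : j \in used -> gen j \in H.
    by apply: gens_mem => // v; rewrite (Vsub v).
  have [rk|rk] : r = k \/ k = r.+1 by move: used_k kr; lia.
    exists (fun i => incl (b (cast_ord (esym rk) i))); split=> [S cS|i].
      move=> x; apply: (@gen_generates k) => _ [j _ <-].
      apply: (mem_of_gens b_basis (S := S)) => [i|].
        by apply: cS; exists (cast_ord rk i); rewrite ?cast_ordK.
      by apply/genH/all_used; rewrite -rE.
    by exists (cast_ord rk i); rewrite cast_ordK.
  have [j0 j0P] : exists j0, forall j, j != j0 -> j \in used.
    have : #|~: used| == 1%N.
      by have := cardsC used; rewrite card_ord; move: rk rE; lia.
    move=> /cards1P[j0 E]; exists j0 => j; apply: contraNT => ju.
    have : j \in ~: used by rewrite finset.inE.
    by rewrite E finset.inE.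
  apply: (complement_gens (x := gen j0) rk) => S HS j0S.
  apply: gen_generates => _ [j _ <-].
  by have [->//|/j0P ju] := eqVneq j j0; apply/HS/genH.
(* Otherwise r + 1 <= |used| <= k forces equality and the bouquet has corank one: one pair generates
   the full congruence, and its pair word completes the basis of H. *)
have r_nd := nondiag_rank b_basis b_inj pres mpH diag_rank cfull nfd.
rewrite nfull efull in r_nd.
have rk : k = r.+1 by move: used_k kr; lia.
have used_all : forall j, j \in used by apply: all_used; move: used_k; lia.
have [u [v [_ uvfull]]] : exists u v, u != v /\ pair_cong step u v = full.
  apply: corank_one_pair; rewrite inE; apply/andP; split; first exact/asboolP.
  by rewrite nfull efull; apply/eqP; move: used_k; lia.
apply: (complement_gens (x := pair_word path u v) rk) => S HS uvS.
apply: gen_generates => _ [j _ <-]; apply: gens_mem => // w.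
have : pair_word path w v0 \in S.
  by apply: (pair_word_mem pres pathP HS uvS); rewrite uvfull inE.
by rewrite /pair_word gpredMr // gpredV HS.
Qed.

End Main.

(** * Free factors, primitive words and uniformity *)

Lemma card_asbool_le (T U : finType) (P : T -> Prop) (Q : U -> Prop) (h : T -> U) :
  (forall x y, P x -> P y -> h x = h y -> x = y) -> (forall x, P x -> Q (h x)) ->
  #|[pred x | `[< P x >]]| <= #|[pred y | `[< Q y >]]|.
Proof.
move=> hI hQ; have memP x : x \in [pred x | `[< P x >]] -> P x by move=> Px; exact/asboolP.
have h_inj : {in [pred x | `[< P x >]] &, injective h} by move=> x y /memP Px /memP Py; exact: hI.
rewrite -(card_in_image h_inj); apply: subset_leq_card; apply/fintype.subsetP => y.
by move=> /fintype.imageP[x xP ->]; apply/asboolP/hQ/memP.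
Qed.

Section Generators.
Variable k : nat.
Local Notation F := (free_group k).

Lemma free_hom_restr (gT : finGroupType) (g : F -> gT) : {morph g : x y / x * y} ->
  free_hom [ffun i => g (gen i)] =1 g.
Proof.
move=> gM; apply: (generates_eq (@free_hom_is_multiplicative _ _ _) gM (@gen_generates k)).
by move=> _ [i _ <-]; rewrite free_hom_gen ffunE.
Qed.

Lemma free_hom_ffun_inj (gT : finGroupType) (f f' : {ffun 'I_k -> gT}) :
  free_hom f =1 free_hom f' -> f = f'.
Proof. by move=> E; apply/ffunP => i; have := E (gen i); rewrite !free_hom_gen. Qed.

Section Basis.
Variable c : 'I_k -> F.
Hypothesis c_gen : generates (range c).

(* As Hom(F, G) is finite, evaluation at k generators is bijective once injective. *)
Lemma generators_hom_inj : injective (free_hom c).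
Proof.
apply: free_hom_inj => gT f.
have [J JE] := @groupClosed_of F (fun=> True) I (fun _ _ _ _ => I) (fun _ _ => I).
pose ev (g : {ffun 'I_k -> gT}) : {ffun 'I_k -> gT} := [ffun i => free_hom g (c i)].
have ev_inj : injective ev.
  move=> g g' /ffunP E; apply: free_hom_ffun_inj.
  apply: (generates_eq (@free_hom_is_multiplicative _ _ _)
    (@free_hom_is_multiplicative _ _ _) c_gen).
  by move=> _ [i _ <-]; have := E i; rewrite !ffunE.
have /codomP[g /ffunP gE] := inj_card_onto ev_inj (leqnn _) [ffun i => f i].
exists J, (free_hom g); split=> [x y _ _|i]; first exact: free_hom_is_multiplicative.
by have := gE i; rewrite !ffunE JE => ->; split=> //; exact/asboolP.
Qed.

(** [free_hom c] is onto because the [c i] generate, and injective by [generators_hom_inj]; the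
    universal property is carried along its inverse. *)
Lemma generators_basis : basis (range c).
Proof.
have cM := @free_hom_is_multiplicative _ _ c.
have /choice[inv invE] : forall x, exists t, free_hom c t = x.
  apply: (generates_ind (P := fun x => exists t, free_hom c t = x) c_gen).
  - by exists 1; exact: morph_one.
  - by move=> _ _ [t <-] [u <-]; exists (t * u); exact: cM.
  - by move=> _ [t <-]; exists t^-1; exact: morph_inv.
  - by move=> _ [i _ <-]; exists (gen i); exact: free_hom_gen.
have inv_c i : inv (c i) = gen i by apply: generators_hom_inj; rewrite invE free_hom_gen.
apply/basisP; split=> // K f; exists (fun x => free_hom (fun i => f (c i)) (inv x)).
  move=> x y; rewrite -(@free_hom_is_multiplicative _ _ (fun i => f (c i))); congr (free_hom _ _).
  by apply: generators_hom_inj; rewrite cM !invE.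
by move=> _ [i _ <-]; rewrite inv_c free_hom_gen.
Qed.

End Basis.
End Generators.

Section FreeFactor.
Variables (k r : nat) (H : groupClosed (free_group k)).

(** Keeping the restriction to the complement and replacing the one to H injects one fibre into
    another, as a homomorphism is determined by its two restrictions. *)
Lemma free_factor_measure_preserving : free_factor H -> measure_preserving H.
Proof.
move=> [H' HH'] gT; split=> [f x y|phi1 phi2 M1 M2].
  by rewrite incl_is_multiplicative free_hom_is_multiplicative.
have le p1 p2 : Hom p1 -> Hom p2 ->
    #|[pred f : {ffun 'I_k -> gT} | `[< (fun h : subgroup H => free_hom f (incl h)) = p1 >]]| <=
    #|[pred f : {ffun 'I_k -> gT} | `[< (fun h : subgroup H => free_hom f (incl h)) = p2 >]]|.
  move=> M1' M2'.
  have /choice[F FE] : forall f : {ffun 'I_k -> gT}, exists f' : {ffun 'I_k -> gT},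
      (forall h : subgroup H, free_hom f' (incl h) = p2 h) /\
      forall h : subgroup H', free_hom f' (incl h) = free_hom f (incl h).
    move=> f; have [q2 q2E] := mult_of M2'.
    have [q q'E] := mult_of (incl_morph (H := H') (@free_hom_is_multiplicative _ _ f)).
    have [g [gH gH'] _] := HH' gT q2 q.
    have gM : {morph g : x y / x * y} by exact: gmulfM.
    exists [ffun i => g (gen i)]; split=> h; rewrite free_hom_restr //.
      by rewrite gH q2E.
    by rewrite gH' q'E.
  apply: (card_asbool_le (h := F)) => [f f' Ef Ef' FF|f _].
    apply: free_hom_ffun_inj.
    have [q1 q1E] := mult_of M1'.
    have [q q'E] := mult_of (incl_morph (H := H') (@free_hom_is_multiplicative _ _ f)).
    have [g _ gU] := HH' gT q1 q.
    have aux (f0 : {ffun 'I_k -> gT}) : (fun h : subgroup H => free_hom f0 (incl h)) = p1 ->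
        F f0 = F f -> free_hom f0 =1 g.
      move=> E0 F0; have [u uE] := mult_of (@free_hom_is_multiplicative _ _ f0).
      move=> x; rewrite -uE; apply: gU; split=> h; rewrite uE ?q1E ?q'E.
        by rewrite -E0.
      by rewrite -(FE f0).2 F0 (FE f).2.
    by move=> x; rewrite (aux _ Ef erefl) (aux _ Ef' (esym FF)).
  by apply/funext => h; rewrite (FE f).1.
by apply/eqP; rewrite eqn_leq !le.
Qed.

Variable b : 'I_r -> subgroup H.
Hypothesis b_basis : basis (range b).

(** The complement is generated by the [c i] outside the basis of H; since the [c i] form a basis,
    homomorphisms on the two parts glue uniquely. *)
Lemma basis_free_factor (c : 'I_k -> free_group k) :
  generates (range c) -> (forall i, exists j, c j = incl (b i)) -> free_factor H.
Proof.
move=> c_gen bc.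
pose rest i := forall j, c i <> incl (b j).
have [||x|H' H'E] := @groupClosed_of (free_group k) (fun x =>
    forall S : groupClosed (free_group k), (forall i, rest i -> c i \in S) -> x \in S).
- by move=> S _; exact: gpred1.
- by move=> x y xS yS S cS; rewrite gpredM ?xS ?yS.
- by move=> xS S cS; rewrite gpredV xS.
exists H' => K f f'.
have [_ eB] := (basisP _).1 (generators_basis c_gen).
pose F0 x : K := if [pick j | incl (b j) == x] is Some j then f (b j) else
  if insub x : option (subgroup H') is Some h then f' h else 1.
have [g0 g0M g0E] := eB K F0.
have gb j : g0 (incl (b j)) = f (b j).
  have [i ci] := bc j; rewrite -ci g0E; last by exists i.
  rewrite /F0 ci; case: pickP => [j' /eqP/val_inj -> //|/(_ j)].
  by rewrite eqxx.
have restH' i : rest i -> c i \in H'.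
  by move=> ri; rewrite H'E; apply/asboolP => S; apply.
have gH' : forall h : subgroup H', g0 (incl h) = f' h.
  have [||x|S SE] := @groupClosed_of (free_group k) (fun x =>
      exists2 h : subgroup H', incl h = x & g0 x = f' h).
  - by exists 1 => //; rewrite (morph_one g0M) (morph_one (@gmulfM _ _ f')).
  - move=> x y [h <- gh] [h' <- gh']; exists (h * h'); first exact: incl_is_multiplicative.
    by rewrite g0M gh gh' gmulfM.
  - move=> [h <- gh]; exists h^-1; first exact: (morph_inv (@incl_is_multiplicative _ _)).
    by rewrite (morph_inv g0M) gh (morph_inv (@gmulfM _ _ f')).
  move=> h; have : incl h \in S.
    have : incl h \in H' := valP h.
    rewrite H'E => /asboolP; apply => i ri; rewrite SE; apply/asboolP.
    exists (exist (fun z => z \in H') _ (restH' i ri)) => //.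
    rewrite g0E; last by exists i.
    rewrite /F0; case: pickP => [j /eqP E|_]; first by case: (ri j).
    by rewrite (insubT (fun z => z \in H') (restH' i ri)).
  by rewrite SE => /asboolP[h' /val_inj -> ].
have [g gE] := mult_of g0M.
exists g => [|g' [g'H g'H'] x].
  split=> h; rewrite gE ?gH' //.
  have fM : {morph f : x y / x * y} by exact: gmulfM.
  exact: (basis_eq b_basis (incl_morph g0M) fM gb).
have g'M : {morph g' : x y / x * y} by exact: gmulfM.
rewrite gE; apply: (generates_eq g'M g0M c_gen) => _ [i _ <-].
have [[j ij]|ri] := pselect (exists j, c i = incl (b j)).
  by rewrite ij gb g'H.
have ri' : rest i by move=> j ij; apply: ri; exists j.
have := g'H' (exist (fun z => z \in H') _ (restH' i ri')).
by rewrite -gH'.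
Qed.

Lemma measure_preserving_generators : injective b -> measure_preserving H -> k - 1 <= r ->
  exists c : 'I_k -> free_group k,
    generates (range c) /\ forall i, exists j, c j = incl (b i).
Proof.
move=> b_inj mpH kr.
have [V [step [v0 pres]]] := presentation_exists b_basis.
have [_ _ /choice[path pathP]] := pres.
exact: (extends_to_generators b_basis b_inj mpH pres pathP kr).
Qed.

End FreeFactor.

(** * Measure preserving words *)

Section Word.
Variables (k : nat) (w : free_group k).

(** Changing the value at [w] and keeping those on the rest of the basis injects one fibre into
    another. *)
Lemma primitive_measure_preserving_word : primitive w -> measure_preserving_word w.
Proof.
move=> [B [bB Bw]] gT; split=> // p1 p2 _ _.
have gB := basis_generates bB.
have le q1 q2 :
    #|[pred f : {ffun 'I_k -> gT} | `[< free_hom f w = q1 >]]| <=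
    #|[pred f : {ffun 'I_k -> gT} | `[< free_hom f w = q2 >]]|.
  have /choice[F FE] : forall f : {ffun 'I_k -> gT}, exists f' : {ffun 'I_k -> gT},
      free_hom f' w = q2 /\ forall x, B x -> x != w -> free_hom f' x = free_hom f x.
    move=> f; have [g gE _] := bB gT (fun x => if x == w then q2 else free_hom f x).
    have gM : {morph g : x y / x * y} by exact: gmulfM.
    exists [ffun i => g (gen i)]; split=> [|x Bx xw]; rewrite free_hom_restr // gE //.
      by rewrite eqxx.
    by rewrite (negPf xw).
  apply: (card_asbool_le (h := F)) => [f f' Ef Ef' FF|f _].
    apply: free_hom_ffun_inj.
    apply: (generates_eq (@free_hom_is_multiplicative _ _ _)
      (@free_hom_is_multiplicative _ _ _) gB) => x Bx.
    have [->|xw] := eqVneq x w; first by rewrite Ef Ef'.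
    by rewrite -(FE f).2 // FF (FE f').2.
  exact: (FE f).1.
by apply/eqP; rewrite eqn_leq !le.
Qed.

Hypothesis mp_w : measure_preserving_word w.

(** The fibre that contains the trivial assignment is not empty, hence by uniformity no fibre is. *)
Lemma measure_preserving_word_onto (gT : finGroupType) (g : gT) :
  exists f : {ffun 'I_k -> gT}, free_hom f w = g.
Proof.
have [_ unif] := mp_w gT; pose f1 : {ffun 'I_k -> gT} := [ffun=> 1].
have := unif (free_hom f1 w) g I I; apply: contraPP => nf.
have -> : #|[pred f : {ffun 'I_k -> gT} | `[< free_hom f w = g >]]| = 0%N.
  by apply: eq_card0 => f; rewrite !inE; apply/asboolP => fg; apply: nf; exists f.
by move=> /card0_eq/(_ f1); rewrite !inE => /asboolP.
Qed.

Let cyc := free_hom (fun _ : 'I_1 => w).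

Let cycM : {morph cyc : x y / x * y}. Proof. exact: free_hom_is_multiplicative. Qed.

(** [w] can be sent to any element of any finite group, so it has infinite order. *)
Let cyc_inj : injective cyc.
Proof.
apply: free_hom_inj => gT f.
have [J JE] := @groupClosed_of (free_group k) (fun=> True) I (fun _ _ _ _ => I) (fun _ _ => I).
have [g gw] := measure_preserving_word_onto (f ord0).
exists J, (free_hom g); split=> [x y _ _|i]; first exact: free_hom_is_multiplicative.
by rewrite (ord1 i) JE; split=> //; exact/asboolP.
Qed.

(** The cyclic group of [w] is free on [w] by [cyc_inj], and a homomorphism on it is its value at
    [w], so uniformity of the word is uniformity of the subgroup. *)
Lemma cyclic_measure_preserving : exists (H : groupClosed (free_group k)) (b : 'I_1 -> subgroup H),
  [/\ basis (range b), measure_preserving H & incl (b ord0) = w].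
Proof.
have [||x|H HE] := @groupClosed_of (free_group k) (fun x => exists t, cyc t = x).
- by exists 1; exact: morph_one.
- by move=> x y [t <-] [u <-]; exists (t * u); exact: cycM.
- by move=> [t <-]; exists t^-1; exact: morph_inv.
have cycH t : cyc t \in H by rewrite HE; apply/asboolP; exists t.
pose psi t : subgroup H := exist (fun z => z \in H) _ (cycH t).
have psiM : {morph psi : x y / x * y} by move=> x y; apply: val_inj; exact: cycM.
have /choice[inv invE] : forall h : subgroup H, exists t, psi t = h.
  move=> h; have : incl h \in H := valP h.
  by rewrite HE => /asboolP[t E]; exists t; exact: val_inj.
have psi_inj : injective psi by move=> t u /(congr1 val) /cyc_inj.
pose b (_ : 'I_1) := psi (gen ord0).
have bw : incl (b ord0) = w by exact: free_hom_gen.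
have bB : basis (range b).
  apply/basisP; split=> [S bS h|K f].
    rewrite -(invE h); apply: (generates_ind (P := fun t => psi t \in S) (@gen_generates 1)).
    - by rewrite (morph_one psiM) gpred1.
    - by move=> t u tS uS; rewrite psiM gpredM.
    - by move=> t tS; rewrite (morph_inv psiM) gpredV.
    - by move=> _ [i _ <-]; apply: bS; exists ord0; rewrite // (ord1 i).
  exists (fun h => free_hom (fun=> f (b ord0)) (inv h)).
    move=> x y; rewrite -(@free_hom_is_multiplicative 1 _ _); congr (free_hom _ _).
    by apply: psi_inj; rewrite psiM !invE.
  move=> _ [i _ <-]; have -> : inv (b i) = gen ord0 by apply: psi_inj; rewrite invE.
  by rewrite free_hom_gen.
exists H, b; split=> // gT; split=> [f|phi1 phi2 M1 M2].
  exact: (incl_morph (@free_hom_is_multiplicative _ _ _)).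
have eqP phi : Hom phi ->
    #|[pred f : {ffun 'I_k -> gT} | `[< (fun h : subgroup H => free_hom f (incl h)) = phi >]]| =
    #|[pred f : {ffun 'I_k -> gT} | `[< free_hom f w = phi (b ord0) >]]|.
  move=> M; apply: eq_card => f; rewrite !inE; apply/asboolP/asboolP => [<-|E].
    by rewrite bw.
  apply: funext; apply: (basis_eq bB (incl_morph (@free_hom_is_multiplicative _ _ _)) M) => i.
  by rewrite (ord1 i) bw.
by rewrite !eqP //; have [_ unif] := mp_w gT; exact: unif.
Qed.

End Word.

Theorem theorem1p5 :
  (forall (k r : nat) (H : groupClosed (free_group k)),
     finitely_generated (subgroup H) -> has_rank (subgroup H) r ->
     k - 1 <= r ->
     (free_factor H <-> measure_preserving H)) /\
  (forall w : free_group 2, primitive w <-> measure_preserving_word w).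
Proof.
split=> [k r H _ /has_rank_range[b b_inj b_basis] kr|w]; split.
- exact: free_factor_measure_preserving.
- move=> mpH; have [c [c_gen bc]] := measure_preserving_generators b_basis b_inj mpH kr.
  exact: basis_free_factor c_gen bc.
- exact: primitive_measure_preserving_word.
(* The subgroup spanned by [w] has rank 1 = 2 - 1, so its basis extends to one of the whole
   group. *)
move=> /cyclic_measure_preserving[H [b [b_basis mpH bw]]].
have b_inj : injective b by move=> i j _; rewrite (ord1 i) (ord1 j).
have [|c [c_gen bc]] := measure_preserving_generators b_basis b_inj mpH; first by [].
exists (range c); split; first exact: generators_basis.
by have [j cj] := bc ord0; exists j; rewrite // cj.
Qed.
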